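(* If a separable Banach space $X$ is $\omega$-categorical, then $\operatorname{Age}(X)$ is a guarded Fraïssé class (and in particular, closed in $\operatorname{BM}$) and $\operatorname{Flim}(X)$ is an $\omega$-categorical space.
   Context: All Banach spaces are real. For $C \geq 0$, $\operatorname{Emb}_C(Y,Z)$ is the set of bounded linear operators $T\colon Y\to Z$ with $e^{-C}\|y\| \le \|Ty\| \le e^{C}\|y\|$ for all $y$; $\operatorname{Emb}(Y,Z)=\operatorname{Emb}_0(Y,Z)$. $\operatorname{Iso}(X)$ is the group of surjective linear isometries of $X$; $B_X$ is the closed unit ball. For a group $G$ acting by isometries on a metric space $M$, let $q(x)=\overline{Gx}$ be the orbit closure of $x\in M$, and let $M/\!/G=\{q(x):x\in M\}$ with the metric $\rho(q(x),q(y))=\inf\{d(z,z') : z\in q(x),z'\in q(y)\}$. An infinite-dimensional separable Banach space $X$ is $\omega$-categorical if $(B_X)^n/\!/\operatorname{Iso}(X)$ is compact for every $n\in\mathbb N$ (diagonal action; $(B_X)^n$ with the $\ell_\infty$ distance $\max_i\|x_i-y_i\|$). $\operatorname{BM}$ is the set of isometry classes of finite-dimensional real normed spaces, topologized as the disjoint union over $n$ of the sets $\operatorname{BM}_n$ of isometry classes of $n$-dimensional spaces, each with the metric $d_{\operatorname{BM}}(E,F)=\inf\{\log(\|T\|\|T^{-1}\|) : T\colon E\to F \text{ isomorphism}\}$. $\operatorname{Age}(X)\subseteq\operatorname{BM}$ is the set of finite-dimensional spaces isometric to a subspace of $X$; $\operatorname{Age}_{cl}(X)$ is its closure in $\operatorname{BM}$.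 A class $\mathcal K\subseteq\operatorname{BM}$ is a guarded Fraïssé class if it is nonempty, closed in $\operatorname{BM}$, and satisfies: (HP) if $F\in\mathcal K$ and $E\in\operatorname{BM}$ embeds isometrically into $F$, then $E\in\mathcal K$; (JEP) for all $F,G\in\mathcal K$ there is $H\in\mathcal K$ into which both $F$ and $G$ embed isometrically; (GAP) for every $E\in\mathcal K$ and $\varepsilon>0$ there exist $F\in\mathcal K$, $\phi\in\operatorname{Emb}_\varepsilon(E,F)$ and $\delta>0$ such that for all $G,H\in\mathcal K$, $\psi_G\in\operatorname{Emb}_\delta(F,G)$, $\psi_H\in\operatorname{Emb}_\delta(F,H)$ there exist $K\in\mathcal K$, $\iota_G\in\operatorname{Emb}(G,K)$, $\iota_H\in\operatorname{Emb}(H,K)$ with $\|\iota_G\circ\psi_G\circ\phi-\iota_H\circ\psi_H\circ\phi\|<\varepsilon$. A separable Banach space $Z$ is guarded Fraïssé if for every finite-dimensional subspace $E\subseteq Z$ and every $\varepsilon>0$ there exist $\delta>0$ and a finite-dimensional subspace $F\subseteq Z$ with $E\subseteq F$ such that for all $\iota,\iota'\in\operatorname{Emb}_\delta(F,Z)$ there is $T\in\operatorname{Iso}(Z)$ with $\|\iota'|_E-T\circ\iota|_E\|<\varepsilon$. When $\operatorname{Age}_{cl}(X)$ is a guarded Fraïssé class, $\operatorname{Flim}(X)$ denotes the guarded Fraïssé Banach space $Z$ with $\operatorname{Age}_{cl}(Z)=\operatorname{Age}_{cl}(X)$; it exists and is unique up to isometry. *)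

(* Defs.v *)
From HB Require Import structures.
From mathcomp Require Import all_boot all_order all_algebra.
From mathcomp Require Import ring lra.
From mathcomp Require Import all_classical all_reals all_analysis.

Set Implicit Arguments.
Unset Strict Implicit.
Unset Printing Implicit Defensive.

Import Order.TTheory GRing.Theory Num.Theory.
Import numFieldNormedType.Exports.

Local Open Scope classical_set_scope.
Local Open Scope ring_scope.

(** ** The metric quotient M//G *)

(* An action by isometries enters only through its orbits, so it is recorded
   by the group of self-maps of M that it induces. *)
Record isometric_action (R : realType) (M : metricType R) := IsometricAction {
  act_maps :> set (M -> M) ;
  act_id : act_maps idfun ;
  act_comp : forall g h, act_maps g -> act_maps h -> act_maps (g \o h) ;
  act_inv : forall g, act_maps g ->
    exists h, [/\ act_maps h, cancel g h & cancel h g] ;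
  act_dist : forall g, act_maps g ->
    forall x y, mdist (g x) (g y) = mdist x y
}.

Section orbit_closures.
Context {R : realType} {M : metricType R} (G : isometric_action M).

Definition orbit_closure (x : M) : set M := closure [set g x | g in act_maps G].

Definition orbit_quotient := {A : set M | exists x, A = orbit_closure x}.

HB.instance Definition _ := gen_eqMixin orbit_quotient.
HB.instance Definition _ := gen_choiceMixin orbit_quotient.

Definition orbit_dist (A B : orbit_quotient) : R :=
  inf [set mdist z.1 z.2 | z in sval A `*` sval B].

Lemma closure_mdistP (A : set M) x :
  closure A x <-> forall e : R, 0 < e -> exists2 a, A a & mdist x a < e.
Proof.
split=> [Ax e e0|Ax U /nbhs_ballP[e /= e0 xeU]].
  have [a [Aa]] := Ax _ (nbhsx_ballx x _ e0).
  by rewrite ballEmdist /= => xa; exists a.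
have [a Aa xa] := Ax _ e0.
by exists a; split => //; apply: xeU; rewrite ballEmdist.
Qed.

Lemma orbit_closure_act x g z :
  act_maps G g -> orbit_closure x z -> orbit_closure x (g z).
Proof.
move=> Gg /closure_mdistP xz; apply/closure_mdistP => e /xz[_ [h Gh <-] zh].
exists (g (h x)); last by rewrite (act_dist Gg).
by exists (g \o h) => //; apply: act_comp.
Qed.

Lemma orbit_closure_near x z w (e : R) : orbit_closure x z ->
  orbit_closure x w -> 0 < e -> exists2 g, act_maps G g & mdist w (g z) < e.
Proof.
move=> /closure_mdistP xz /closure_mdistP xw e0.
have e20 : 0 < e / 2 by rewrite divr_gt0.
have [_ [g Gg <-] zg] := xz _ e20.
have [_ [h Gh <-] wh] := xw _ e20.
have [g' [Gg' gg' g'g]] := act_inv Gg.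
exists (h \o g'); first exact: act_comp.
rewrite (le_lt_trans (metric_triangle _ (h x) _))// (splitr e) ltrD// /=.
by rewrite (act_dist Gh) -(act_dist Gg) g'g metric_sym.
Qed.

Lemma orbit_closure_refl x : orbit_closure x x.
Proof. by apply: subset_closure; exists idfun => //; apply: act_id. Qed.

Lemma orbit_dist_le (A B : orbit_quotient) z w :
  sval A z -> sval B w -> orbit_dist A B <= mdist z w.
Proof.
move=> Az Bw; apply: ge_inf; last by exists (z, w).
by exists 0 => _ [? _ <-]; exact: mdist_ge0.
Qed.

Lemma orbit_dist_lt (A B : orbit_quotient) (e : R) : orbit_dist A B < e ->
  exists z w, [/\ sval A z, sval B w & mdist z w < e].
Proof.
case: A B => [A [a Ea]] [B [b Eb]]; rewrite /orbit_dist /=.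
case/inf_lt => [|_ [[z w] [/= Az Bw] <-] zw]; last by exists z, w.
exists (mdist a b); exists (a, b) => //=; rewrite Ea Eb.
by split; exact: orbit_closure_refl.
Qed.

Lemma orbit_distxx A : orbit_dist A A = 0.
Proof.
have [a Ea] := proj2_sig A; apply/eqP; rewrite eq_le; apply/andP; split.
  by rewrite -(mdistxx a); apply: orbit_dist_le; rewrite Ea;
    exact: orbit_closure_refl.
by rewrite leNgt; apply/negP => /orbit_dist_lt[z [w [_ _]]]; rewrite ltNge mdist_ge0.
Qed.

Lemma orbit_dist_sym A B : orbit_dist A B = orbit_dist B A.
Proof.
by congr inf; apply/seteqP; split=> _ [[z w] [/= Az Bw] <-]; exists (w, z) => //;
  rewrite metric_sym.
Qed.

Lemma orbit_dist_eq0 A B : orbit_dist A B = 0 -> A = B.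
Proof.
suff sub C D : orbit_dist C D = 0 -> sval C `<=` sval D.
  move=> AB; have BA : orbit_dist B A = 0 by rewrite orbit_dist_sym.
  have : sval A = sval B by apply/seteqP; split; exact: sub.
  by case: A B {AB BA} => [A a] [B b] /= AB; exact: eq_exist.
have [x Ex] := proj2_sig C; have [y Ey] := proj2_sig D.
move=> CD w; rewrite Ex Ey => xw.
apply: closed_closure; apply/closure_mdistP => e e0.
have e20 : 0 < e / 2 by rewrite divr_gt0.
have /orbit_dist_lt[c [d []]] : orbit_dist C D < e / 2 by rewrite CD.
rewrite Ex Ey => xc yd cd; have [g Gg wgc] := orbit_closure_near xc xw e20.
exists (g d); first exact: orbit_closure_act.
by rewrite (le_lt_trans (metric_triangle _ (g c) _))// (splitr e) ltrD// (act_dist Gg).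
Qed.

Lemma orbit_dist_triangle B A C : orbit_dist A C <= orbit_dist A B + orbit_dist B C.
Proof.
apply/ler_addgt0Pr => e e0.
have e30 : 0 < e / 3 by rewrite divr_gt0.
have /orbit_dist_lt[a [b [Aa Bb ab]]] : orbit_dist A B < orbit_dist A B + e / 3.
  by rewrite ltrDl.
have /orbit_dist_lt[b' [c [Bb' Cc b'c]]] : orbit_dist B C < orbit_dist B C + e / 3.
  by rewrite ltrDl.
have [y Ey] := proj2_sig B; have [z Ez] := proj2_sig C.
move: Bb Bb'; rewrite Ey => Bb Bb'.
have [g Gg bgb'] := orbit_closure_near Bb' Bb e30.
have Cgc : sval C (g c) by move: Cc; rewrite Ez; exact: orbit_closure_act.
apply: (le_trans (orbit_dist_le Aa Cgc)).
apply: (le_trans (metric_triangle _ b _)).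
apply: (le_trans (lerD (ltW ab) (metric_triangle _ (g b') _))).
rewrite (act_dist Gg); apply: (le_trans (lerD (lexx _) (lerD (ltW bgb') (ltW b'c)))).
by rewrite le_eqVlt; apply/orP; left; apply/eqP; field.
Qed.

HB.instance Definition _ := isMetric.Build R orbit_quotient
  orbit_distxx orbit_dist_eq0 orbit_dist_sym orbit_dist_triangle.

End orbit_closures.

(** ** Operators between normed spaces *)

Section operators.
Context {R : realType}.
Implicit Types Y Z : normedModType R.

(* Only meaningful for maps that are bounded on the closed unit ball, such as
   linear maps on a finite-dimensional space: see [opnorm_has_ubound]. *)
Definition opnorm Y Z (f : Y -> Z) : R := sup [set `|f y| | y in [set y | `|y| <= 1]].

Definition Emb (C : R) Y Z : set {linear Y -> Z} :=
  [set T | forall y, expR (- C) * `|y| <= `|T y| <= expR C * `|y|].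

Definition Iso Z : set {linear Z -> Z} :=
  [set T | (forall z, `|T z| = `|z|) /\ range T = setT].

Definition isometric Y Z :=
  exists T : {linear Y -> Z}, (forall y, `|T y| = `|y|) /\ range T = setT.

Definition span Z n (v : 'I_n -> Z) : set Z :=
  [set \sum_i c i *: v i | c in [set: 'I_n -> R]].

Definition infinite_dimensional Z :=
  ~ exists n (v : 'I_n -> Z), span v = setT.

Definition separable (T : topologicalType) :=
  exists2 D : set T, countable D & dense D.

End operators.

Arguments Emb {R} C Y Z _.
Arguments Iso {R} Z _.
Arguments isometric {R} Y Z.

(** ** Finite-dimensional subspaces *)

Record fdsubspace (R : realType) (Z : normedModType R) := FdSubspace {
  fdsub_set : set Z ;
  fdsub_fin : exists n (v : 'I_n -> Z), fdsub_set = span v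
}.

Section fdsubspace_normed.
Context {R : realType} {Z : normedModType R} (E : fdsubspace Z).

Definition fdsub_pred : {pred Z} := fun z => `[< fdsub_set E z >].

Lemma fdsub_submod_closed : submod_closed fdsub_pred.
Proof.
have [n [v Ev]] := fdsub_fin E; split=> [|a x y].
  rewrite unfold_in; apply/asboolP; rewrite Ev; exists (fun=> 0) => //.
  by rewrite big1// => i _; rewrite scale0r.
rewrite !unfold_in => /asboolP Ex /asboolP Ey; apply/asboolP; move: Ex Ey.
rewrite Ev => -[c _ <-] [d _ <-]; exists (fun i => a * c i + d i) => //.
rewrite scaler_sumr -big_split; apply: eq_bigr => i _ /=.
by rewrite scalerDl scalerA.
Qed.

HB.instance Definition _ :=
  GRing.isSubmodClosed.Build R Z fdsub_pred fdsub_submod_closed.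

Record fdsub_sort := FdSub { fdsub_val : Z ; fdsub_valP : fdsub_val \in fdsub_pred }.

HB.instance Definition _ := [isSub for fdsub_val].
HB.instance Definition _ := [Choice of fdsub_sort by <:].
HB.instance Definition _ := [SubChoice_isSubLmodule of fdsub_sort by <:].

Definition fdsub_norm (x : fdsub_sort) : R := `|fdsub_val x|.

Lemma fdsub_normD x y : fdsub_norm (x + y) <= fdsub_norm x + fdsub_norm y.
Proof. exact: ler_normD. Qed.

Lemma fdsub_normZ (a : R) x : fdsub_norm (a *: x) = `|a| * fdsub_norm x.
Proof. exact: normrZ. Qed.

Lemma fdsub_norm0_eq0 x : fdsub_norm x = 0 -> x = 0.
Proof. by move=> /normr0_eq0 x0; apply: val_inj. Qed.

HB.instance Definition _ := Lmodule_isNormed.Build R fdsub_sort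
  fdsub_normD fdsub_normZ fdsub_norm0_eq0.

Lemma mem_fdsub (x : fdsub_sort) : fdsub_set E (fdsub_val x).
Proof. by case: x => z /=; rewrite unfold_in => /asboolP. Qed.

End fdsubspace_normed.

Coercion fdsub_sort : fdsubspace >-> Sortclass.

Definition fdsub_incl (R : realType) (Z : normedModType R) (E F : fdsubspace Z)
    (EF : fdsub_set E `<=` fdsub_set F) (x : E) : F :=
  @FdSub R Z F (fdsub_val x) (asboolT (EF _ (mem_fdsub x))).

(** ** The space BM of finite-dimensional normed spaces *)

(* An isometry class is represented by any of its members whose underlying
   vector space is R^n; subsets of BM are the isometry-invariant sets. Closed
   sets and sets with the hereditary property are isometry-invariant. *)
Record fdspace (R : realType) := FdSpace {
  fddim : nat ;
  fdnorm : 'rV[R]_fddim -> R ;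
  fdnormD : forall x y, fdnorm (x + y) <= fdnorm x + fdnorm y ;
  fdnormZ : forall (a : R) x, fdnorm (a *: x) = `|a| * fdnorm x ;
  fdnorm0_eq0 : forall x, fdnorm x = 0 -> x = 0
}.

(* A copy of R^n that does not inherit the sup norm of 'rV[R]_n. *)
Definition fdspace_sort (R : realType) (E : fdspace R) : Type := 'rV[R]_(fddim E).
Coercion fdspace_sort : fdspace >-> Sortclass.

Section fdspace_normed.
Context {R : realType} (E : fdspace R).

HB.instance Definition _ := GRing.Lmodule.copy (fdspace_sort E) 'rV[R]_(fddim E).
HB.instance Definition _ := Lmodule_isNormed.Build R (fdspace_sort E)
  (@fdnormD R E) (@fdnormZ R E) (@fdnorm0_eq0 R E).

End fdspace_normed.

Section Banach_Mazur.
Context {R : realType}.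
Implicit Types E F G : fdspace R.

(* [ln 0 = 0], so the two spaces of dimension 0 are at distance 0. *)
Definition BMdist_set E F : set R :=
  [set d | exists (T : {linear E -> F}) (S : {linear F -> E}),
    [/\ cancel T S, cancel S T & d = ln (opnorm T * opnorm S)]].

Definition BMdist E F : R := inf (BMdist_set E F).

Definition BMball E (e : R) : set (fdspace R) :=
  [set F | fddim E = fddim F /\ BMdist E F < e].

Lemma fdnorm_ge0 E x : 0 <= @fdnorm R E x.
Proof. exact: (normr_ge0 (x : E)). Qed.

Lemma le_coord_mx_norm n (x : 'rV[R]_n) j : `|x 0 j| <= `|x|.
Proof.
by rewrite [leRHS]/Num.norm /= mx_normrE; apply/bigmax_geP; right => /=; exists (ord0, j).
Qed.

Lemma fdnorm_le E : exists2 C : R, 0 <= C &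
  forall x : 'rV[R]_(fddim E), fdnorm x <= C * `|x|.
Proof.
exists (\sum_j fdnorm (delta_mx 0 j : 'rV[R]_(fddim E))) => [|x].
  by apply: sumr_ge0 => j _; exact: fdnorm_ge0.
have xE : (x : E) = \sum_j x 0 j *: (delta_mx 0 j : E) by exact: row_sum_delta.
change (`|x : E| <= (\sum_j `|delta_mx 0 j : E|) * `|x|).
rewrite {1}xE (le_trans (ler_norm_sum _ _ _))// mulr_suml; apply: ler_sum => j _.
by rewrite normrZ mulrC ler_wpM2l// le_coord_mx_norm.
Qed.

Lemma fdnorm_continuous E : continuous (@fdnorm R E).
Proof.
have [C C0 EC] := fdnorm_le E.
move=> x; apply/(@cvgrPdist_le _ _ _ (nbhs x)) => e e0.
have C1 : 0 < C + 1 by rewrite ltr_wpDl.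
near=> y.
have xy : `|x - y| <= e / (C + 1).
  near: y; apply: (@cvgr_dist_le _ _ _ (nbhs x) _ idfun); first exact: cvg_id.
  by rewrite divr_gt0.
rewrite (le_trans (ler_dist_dist (x : E) y))// (le_trans (EC (x - y)))//.
rewrite (le_trans (ler_wpM2l C0 xy))// mulrCA -[leRHS]mulr1 ler_wpM2l//.
  exact: ltW.
by rewrite ler_pdivrMr// mul1r lerDl.
Unshelve. all: by end_near. Qed.

Lemma fdspace_norm_equiv E : exists2 K : R, 0 < K &
  forall x : 'rV[R]_(fddim E), `|x| <= K * fdnorm x.
Proof.
have [triv|/existsNP[x0 /eqP x00]] :=
  pselect (forall x : 'rV[R]_(fddim E), x = 0).
  by exists 1 => // x; rewrite (triv x) normr0 mul1r fdnorm_ge0.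
pose S := [set x : 'rV[R]_(fddim E) | `|x| = 1].
have cS : compact S.
  apply: bounded_closed_compact.
    by exists 1; split => // t t1 x /= ->; exact: ltW.
  apply: (@closed_comp _ _ _ [set 1 : R]); last exact: closed_eq.
  by move=> x _; exact: norm_continuous.
have S0 : S !=set0.
  exists (`|x0|^-1 *: x0).
  by rewrite /S/= normrZ normfV normr_id mulVf// normr_eq0.
have [c] := EVT_min_rV S0 cS (continuous_subspaceT (@fdnorm_continuous E)).
rewrite inE => Sc cmin.
have c0 : 0 < fdnorm c.
  rewrite lt_neqAle fdnorm_ge0 andbT eq_sym; apply/eqP => /fdnorm0_eq0 c0.
  by move: Sc; rewrite /S/= c0 normr0 => /esym/eqP; rewrite oner_eq0.
exists (fdnorm c)^-1; first by rewrite invr_gt0.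
move=> x; have [->|x0'] := eqVneq x 0.
  by rewrite normr0 mulr_ge0 ?invr_ge0 ?fdnorm_ge0.
have x'0 : 0 < `|x| by rewrite normr_gt0.
have : fdnorm c <= fdnorm (`|x|^-1 *: x).
  by apply: cmin; rewrite inE /S/= normrZ normfV normr_id mulVf// gt_eqF.
rewrite fdnormZ normfV normr_id => cx.
by rewrite mulrC ler_pdivlMr// -ler_pdivlMl.
Qed.

Lemma fdspace_linear_bounded E (Z : normedModType R) (T : {linear E -> Z}) :
  exists C : R, forall x : E, `|T x| <= C * `|x|.
Proof.
have [K K0 EK] := fdspace_norm_equiv E.
exists ((\sum_j `|T (delta_mx 0 j)|) * K) => x.
rewrite -mulrA (le_trans _ (ler_wpM2l _ (EK x)))//; last exact: sumr_ge0.
have xE : x = \sum_j x 0 j *: (delta_mx 0 j : E) by exact: row_sum_delta.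
rewrite {1}xE linear_sum (le_trans (ler_norm_sum _ _ _))//.
rewrite mulr_suml; apply: ler_sum => j _.
rewrite linearZ normrZ mulrC ler_wpM2l//.
exact: le_coord_mx_norm.
Qed.

Lemma opnorm_has_ubound E (Z : normedModType R) (T : {linear E -> Z}) :
  has_ubound [set `|T y| | y in [set y | `|y| <= 1]].
Proof.
have [C TC] := fdspace_linear_bounded T.
exists `|C| => _ [y /= y1 <-]; rewrite (le_trans (TC y))//.
rewrite (le_trans (ler_wpM2r _ (ler_norm C)))//.
by rewrite -[leRHS]mulr1 ler_wpM2l.
Qed.

Lemma opnorm_ge0 E (Z : normedModType R) (T : {linear E -> Z}) : 0 <= opnorm T.
Proof.
apply: (ub_le_sup (opnorm_has_ubound T)).
by exists 0; rewrite /= ?linear0 normr0.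
Qed.

Lemma le_opnorm E (Z : normedModType R) (T : {linear E -> Z}) x :
  `|T x| <= opnorm T * `|x|.
Proof.
have [->|x0] := eqVneq x 0; first by rewrite linear0 !normr0 mulr0.
have x'0 : 0 < `|x| by rewrite normr_gt0.
rewrite -ler_pdivrMr// mulrC.
apply: (ub_le_sup (opnorm_has_ubound T)).
exists (`|x|^-1 *: x); first by rewrite /= normrZ normfV normr_id mulVf// gt_eqF.
by rewrite linearZ normrZ normfV normr_id.
Qed.

Lemma opnorm_le (Y Z : normedModType R) (f : Y -> Z) (C : R) : 0 <= C ->
  (forall y, `|f y| <= C * `|y|) -> opnorm f <= C.
Proof.
move=> C0 fC; apply: ge_sup.
  by exists `|f 0|, 0 => //=; rewrite normr0.
move=> _ [y /= y1 <-]; rewrite (le_trans (fC y))//.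
by rewrite -[leRHS]mulr1 ler_wpM2l.
Qed.

Lemma opnorm_trivial E (Z : normedModType R) (T : {linear E -> Z}) :
  (forall x : E, x = 0) -> opnorm T = 0.
Proof.
move=> E0; apply/eqP; rewrite eq_le opnorm_ge0 andbT.
by apply: opnorm_le => // y; rewrite (E0 y) linear0 !normr0 mulr0.
Qed.

Lemma opnorm_comp E F (Z : normedModType R) (T : {linear E -> F})
    (T' : {linear F -> Z}) : opnorm (T' \o T) <= opnorm T' * opnorm T.
Proof.
apply: opnorm_le => [|y]; first by rewrite mulr_ge0 ?opnorm_ge0.
by rewrite (le_trans (le_opnorm T' _))// -mulrA ler_wpM2l ?le_opnorm ?opnorm_ge0.
Qed.

Lemma opnorm_cancel_ge1 E F (T : {linear E -> F}) (S : {linear F -> E}) (x : E) :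
  x != 0 -> cancel T S -> 1 <= opnorm T * opnorm S.
Proof.
move=> x0 TS; have x'0 : 0 < `|x| by rewrite normr_gt0.
rewrite -(ler_pM2r x'0) mul1r -[X in `|X| <= _](TS x).
rewrite (le_trans (le_opnorm S _))// [opnorm T * _]mulrC -mulrA.
by rewrite ler_wpM2l ?opnorm_ge0 ?le_opnorm.
Qed.

Lemma BMdist_set_refl E : BMdist_set E E 0.
Proof.
exists idfun, idfun; split => //.
have [[x /eqP x0]|/forallNP E0] := pselect (exists x : E, x <> 0).
  have id1 : opnorm (idfun : {linear E -> E}) <= 1.
    by apply: opnorm_le => // y; rewrite mul1r.
  have id2 := @opnorm_cancel_ge1 E E idfun idfun x x0 (fun=> erefl).
  have id0 := @opnorm_ge0 E E idfun.
  suff -> : opnorm (idfun : {linear E -> E}) * opnorm (idfun : {linear E -> E}) = 1.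
    by rewrite ln1.
  by apply/eqP; rewrite eq_le id2 andbT mulr_ile1.
rewrite (@opnorm_trivial E E idfun) ?mulr0 ?ln0// => x.
by apply: contrapT; exact: E0.
Qed.

Lemma BMdist_set_ge0 E F d : BMdist_set E F d -> 0 <= d.
Proof.
move=> [T [S [TS ST ->]]].
have [[x /eqP x0]|/forallNP E0] := pselect (exists x : E, x <> 0).
  exact/ln_ge0/(opnorm_cancel_ge1 x0 TS).
rewrite (opnorm_trivial T) ?mul0r ?ln0// => x.
by apply: contrapT; exact: E0.
Qed.

Lemma BMdist_set_sym E F : BMdist_set E F `<=` BMdist_set F E.
Proof. by move=> _ [T [S [TS ST ->]]]; exists S, T; rewrite mulrC. Qed.

Lemma BMball_center E (e : R) : 0 < e -> BMball E e E.
Proof.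
move=> e0; split => //; apply: le_lt_trans e0.
apply: ge_inf; last exact: BMdist_set_refl.
by exists 0 => d; exact: BMdist_set_ge0.
Qed.

Lemma BMball_sym E F (e : R) : BMball E e F -> BMball F e E.
Proof.
rewrite /BMball /BMdist /= => -[EF dEF]; split => //.
by rewrite (_ : BMdist_set F E = BMdist_set E F)//; apply/seteqP;
  split; exact: BMdist_set_sym.
Qed.

Lemma BMdist_set_comp E F G d d' : BMdist_set E F d -> BMdist_set F G d' ->
  exists2 d'', BMdist_set E G d'' & d'' <= d + d'.
Proof.
move=> EF FG; have dd0 := addr_ge0 (BMdist_set_ge0 EF) (BMdist_set_ge0 FG).
case: EF FG dd0 => T [S [TS ST ->]] [T' [S' [TS' ST' ->]]] dd0.
pose U : {linear E -> G} := T' \o T; pose V : {linear G -> E} := S \o S'.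
have UV : cancel U V by move=> x; rewrite /U /V /= TS' TS.
have VU : cancel V U by move=> x; rewrite /U /V /= ST ST'.
exists (ln (opnorm U * opnorm V)); first by exists U, V.
have [[x /eqP x0]|/forallNP E0] := pselect (exists x : E, x <> 0); last first.
  rewrite (opnorm_trivial U) ?mul0r ?(ln0 (lexx 0))// => x.
  by apply: contrapT; exact: E0.
have TS1 := opnorm_cancel_ge1 x0 TS.
have Tx0 : T x != 0.
  by apply: contra_neq x0 => Tx; rewrite -(TS x) Tx linear0.
have TS'1 := opnorm_cancel_ge1 Tx0 TS'.
have UV1 := opnorm_cancel_ge1 x0 UV.
rewrite -lnM ?posrE ?(lt_le_trans ltr01)//.
rewrite ler_ln ?posrE ?(lt_le_trans ltr01)//; last first.
  by rewrite mulr_ege1.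
rewrite (le_trans (ler_pM (opnorm_ge0 U) (opnorm_ge0 V)
  (opnorm_comp T T') (opnorm_comp S' S)))//.
by rewrite le_eqVlt; apply/orP; left; apply/eqP; ring.
Qed.

Lemma BMdist_set_neq0 E F : fddim E = fddim F -> BMdist_set E F !=set0.
Proof.
case: E F => n p pD pZ p0 [m q qD qZ q0] /= nm; subst m.
pose E := FdSpace pD pZ p0; pose F := FdSpace qD qZ q0.
have lin : linear (id : E -> F) by [].
have lin' : linear (id : F -> E) by [].
pose T := GRing.isLinear.Build _ E F *:%R _ lin.
pose S := GRing.isLinear.Build _ F E *:%R _ lin'.
pose T' : {linear E -> F} := HB.pack (id : E -> F) T.
pose S' : {linear F -> E} := HB.pack (id : F -> E) S.
by exists (ln (opnorm T' * opnorm S')), T', S'.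
Qed.

Lemma BMball_triangle E F G (e1 e2 : R) :
  BMball E e1 F -> BMball F e2 G -> BMball E (e1 + e2) G.
Proof.
move=> [EF dEF] [FG dFG]; split; first exact: etrans FG.
have [d dP de1] := inf_lt (BMdist_set_neq0 EF) dEF.
have [d' d'P de2] := inf_lt (BMdist_set_neq0 FG) dFG.
have [d'' d''P dd] := BMdist_set_comp dP d'P.
apply: le_lt_trans (ltrD de1 de2); apply: le_trans dd.
by apply: ge_inf d''P; exists 0 => x; exact: BMdist_set_ge0.
Qed.

HB.instance Definition _ := gen_eqMixin (fdspace R).
HB.instance Definition _ := gen_choiceMixin (fdspace R).
HB.instance Definition _ :=
  hasNbhs.Build (fdspace R) (nbhs_ (entourage_ BMball)).
HB.instance Definition _ := Nbhs_isPseudoMetric.Build R (fdspace R)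
  erefl BMball_center BMball_sym BMball_triangle erefl.

End Banach_Mazur.

(** ** Omega-categorical spaces *)

Section ball_tuples.
Context {R : realType} (X : normedModType R) (n : nat).

Definition ball_tuple := {x : 'I_n -> X | forall i, `|x i| <= 1}.

HB.instance Definition _ := gen_eqMixin ball_tuple.
HB.instance Definition _ := gen_choiceMixin ball_tuple.

Definition ball_tuple_dist (x y : ball_tuple) : R :=
  \big[Num.max/0]_(i < n) `|sval x i - sval y i|.

Lemma ball_tuple_eq (x y : ball_tuple) : sval x =1 sval y -> x = y.
Proof. by case: x y => [x xP] [y yP] /= /funext; exact: eq_exist. Qed.

Lemma ball_tuple_distxx x : ball_tuple_dist x x = 0.
Proof.
rewrite /ball_tuple_dist; elim/big_ind : _ => // [_ _ -> ->|i _].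
  by rewrite maxxx.
by rewrite subrr normr0.
Qed.

Lemma le_ball_tuple_dist x y i : `|sval x i - sval y i| <= ball_tuple_dist x y.
Proof. by apply/bigmax_geP; right; exists i. Qed.

Lemma ball_tuple_dist_eq0 x y : ball_tuple_dist x y = 0 -> x = y.
Proof.
move=> xy; apply: ball_tuple_eq => i; apply/eqP; rewrite -subr_eq0 -normr_le0.
by rewrite -xy le_ball_tuple_dist.
Qed.

Lemma ball_tuple_dist_sym x y : ball_tuple_dist x y = ball_tuple_dist y x.
Proof. by apply: eq_bigr => i _; rewrite distrC. Qed.

Lemma ball_tuple_dist_triangle y x z :
  ball_tuple_dist x z <= ball_tuple_dist x y + ball_tuple_dist y z.
Proof.
have d0 u v : 0 <= ball_tuple_dist u v by apply/bigmax_geP; left.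
apply/bigmax_leP; split=> [|i _]; first exact: addr_ge0.
rewrite (le_trans (ler_distD (sval y i) _ _))//.
by rewrite lerD// le_ball_tuple_dist.
Qed.

HB.instance Definition _ := isMetric.Build R ball_tuple ball_tuple_distxx
  ball_tuple_dist_eq0 ball_tuple_dist_sym ball_tuple_dist_triangle.

Definition diagonal_act (T : X -> X) (g : ball_tuple -> ball_tuple) :=
  forall x i, sval (g x) i = T (sval x i).

(* The self-maps of (B_X)^n induced by Iso(X). *)
Definition Iso_maps : set (ball_tuple -> ball_tuple) :=
  [set g | exists2 T, Iso X T & diagonal_act T g].

Lemma diagonal_act_ex T : Iso X T -> exists g, diagonal_act T g.
Proof.
move=> [T1 _].
have gP (x : ball_tuple) i : `|T (sval x i)| <= 1.
  by rewrite T1; apply: (proj2_sig x).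
by exists (fun x => exist _ (fun i => T (sval x i)) (gP x)).
Qed.

Lemma Iso_maps_id : Iso_maps idfun.
Proof.
exists idfun => //; split => //.
by apply/seteqP; split => // x _; exists x.
Qed.

Lemma Iso_maps_comp g h : Iso_maps g -> Iso_maps h -> Iso_maps (g \o h).
Proof.
move=> [T [T1 TT] gT] [S [S1 SS] hS]; exists (T \o S).
  split=> [x /=|]; first by rewrite T1.
  apply/seteqP; split => // y _.
  have [x _ <-] : range T y by rewrite TT.
  have [w _ <-] : range S x by rewrite SS.
  by exists w.
by move=> x i /=; rewrite gT hS.
Qed.

Lemma Iso_inv T : Iso X T -> exists S, [/\ Iso X S, cancel T S & cancel S T].
Proof.
move=> [T1 TT].
have Tsurj y : exists x, T x = y.
  by have [x _ <-] : range T y; [rewrite TT | exists x].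
pose S y := projT1 (cid (Tsurj y)).
have ST : cancel S T by move=> y; exact: (projT2 (cid (Tsurj y))).
have TS : cancel T S.
  move=> x; apply/eqP; rewrite -subr_eq0 -normr_eq0 -T1 linearB ST subrr.
  by rewrite normr0.
have linS : linear S.
  by move=> a x y; rewrite -[RHS]TS linearD linearZ /= !ST.
pose S' : {linear X -> X} := HB.pack S (GRing.isLinear.Build _ X X *:%R S linS).
exists S'; split => //; split=> [x|].
  by rewrite -(T1 (S' x)); congr (`|_|); exact: ST.
by apply/seteqP; split => // x _; exists (T x).
Qed.

Lemma Iso_maps_inv g : Iso_maps g ->
  exists h, [/\ Iso_maps h, cancel g h & cancel h g].
Proof.
move=> [T TI gT]; have [S [SI TS ST]] := Iso_inv TI.
have [h hS] := diagonal_act_ex SI; exists h; split; first by exists S.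
  by move=> x; apply: ball_tuple_eq => i; rewrite hS gT.
by move=> x; apply: ball_tuple_eq => i; rewrite gT hS.
Qed.

Lemma Iso_maps_dist g : Iso_maps g -> forall x y, mdist (g x) (g y) = mdist x y.
Proof.
move=> [T [T1 _] gT] x y; apply: eq_bigr => i _.
by rewrite !gT -linearB T1.
Qed.

Definition Iso_action : isometric_action ball_tuple :=
  IsometricAction Iso_maps_id Iso_maps_comp Iso_maps_inv Iso_maps_dist.

End ball_tuples.

Definition omega_categorical (R : realType) (X : completeNormedModType R) :=
  [/\ infinite_dimensional X, separable X &
    forall n, compact [set: orbit_quotient (Iso_action X n)]].

(** ** Guarded Fraisse classes and spaces *)

Section guarded_Fraisse.
Context {R : realType}.
Implicit Types (K : set (fdspace R)) (E F G H L : fdspace R).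

Definition HP K := forall E F, K F -> Emb 0 E F !=set0 -> K E.

Definition JEP K := forall F G, K F -> K G ->
  exists H, [/\ K H, Emb 0 F H !=set0 & Emb 0 G H !=set0].

Definition GAP K := forall E (e : R), K E -> 0 < e ->
  exists F (phi : {linear E -> F}) (d : R), [/\ K F, Emb e E F phi, 0 < d &
    forall G H (psiG : {linear F -> G}) (psiH : {linear F -> H}),
      K G -> K H -> Emb d F G psiG -> Emb d F H psiH ->
      exists L (iG : {linear G -> L}) (iH : {linear H -> L}),
        [/\ K L, Emb 0 G L iG, Emb 0 H L iH &
          opnorm (fun x => iG (psiG (phi x)) - iH (psiH (phi x))) < e]].

Definition guarded_Fraisse_class K :=
  [/\ K !=set0, closed K, HP K, JEP K & GAP K].

Definition Age (X : normedModType R) : set (fdspace R) :=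
  [set E : fdspace R | exists F : fdsubspace X, isometric E F].

Definition Age_cl (X : normedModType R) : set (fdspace R) := closure (Age X).

Definition guarded_Fraisse_space (Z : completeNormedModType R) :=
  separable Z /\
  forall (E : fdsubspace Z) (e : R), 0 < e ->
    exists (d : R) (F : fdsubspace Z) (EF : fdsub_set E `<=` fdsub_set F),
      0 < d /\
      forall i i' : {linear F -> Z}, Emb d F Z i -> Emb d F Z i' ->
        exists2 T, Iso Z T &
          opnorm (fun x : E => i' (fdsub_incl EF x) - T (i (fdsub_incl EF x))) < e.

(* Z is a model of Flim(X), which is determined up to isometry. *)
Definition is_Flim (X Z : completeNormedModType R) :=
  guarded_Fraisse_space Z /\ Age_cl Z = Age_cl X.

End guarded_Fraisse.

(* Main.v *)
From HB Require Import structures.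
Require Import Defs.
From mathcomp Require Import all_boot all_order all_algebra.
From mathcomp Require Import zify ring lra.
From mathcomp Require Import all_classical all_reals all_analysis.

Set Implicit Arguments.
Unset Strict Implicit.
Unset Printing Implicit Defensive.

Import Order.TTheory GRing.Theory Num.Theory.
Import numFieldNormedType.Exports.

Local Open Scope classical_set_scope.
Local Open Scope ring_scope.

(** Finite-dimensional subspaces are handled through finite tuples of vectors.
    Two tuples are [sim] with error [d] when the norms of their combinations
    differ by at most [d] times the l1 norm of the coefficients; error 0 means
    isometric. In an omega-categorical space X, compactness of the spaces of
    orbits says two things: a tuple almost isometric to a given one is close to
    an isometric one ([sim0_of_sim]), and bounded tuples have finite nets up to
    isometries of X ([orbit_net_exists]). The first gives that Age(X) is closed;
    HP holds in every age, and JEP holds because two subspaces of X span a third.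

    The heart is the existence of guards ([guarded_exists]). Given a tuple [x] of
    length [n], look at all its isometric extensions [y] in X, and at the balls of
    a finite net that the first [n] entries of the isometric copies of [y] can
    reach. A longer extension reaches fewer balls; take [y] reaching as few as
    possible. Then every further extension of [y] reaches the same balls, so each
    copy of [y] can be extended as any abstract extension of [y] in the age
    prescribes, at the price of moving its first [n] entries a little. Two
    extensions of a guard can therefore be realized in X so that they almost agree
    on [x], and their span is the amalgam required by GAP ([Age_GAP]).

    The limit is built inside X. A sequence of vectors is constructed in stages;
    each stage answers one of countably many requests for a copy of a tuple of X,
    adds a guard, and moves the earlier vectors only a little, by the guards of
    the earlier stages ([generic_sequence]). The closed span Z of the limit
    sequence then has the extension property: each tuple of Z has an extension in
    Z over which all almost isometric tuples can be copied back, near the original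
    tuple ([limit_extension]). A back and forth turns this into isometries
    ([extension_homogeneous]), so Z is a guarded Fraisse space
    ([extension_guarded_Fraisse]); requests over the empty tuple show that the
    ages of Z and X have the same closure.

    Let now Z be any guarded Fraisse space with that closure. Given two tuples of
    Z, the guards of both embed into X. If the copies of the tuples are close up to
    an isometry of X, the two guards live in one subspace of X, which almost embeds
    back into Z, and the definition of guards makes the tuples close up to an
    isometry of Z. So nets of tuples of X give nets of tuples of Z
    ([limit_orbit_net]); as the orbits of tuples of Z form a complete space, it is
    compact ([compact_of_orbit_net]). *)

(** * Finite tuples and their almost isometries *)

Section tuples.
Context {R : realType}.
Implicit Types (U V W : normedModType R).

Definition lc (V : lmodType R) n (c : nat -> R) (x : nat -> V) : V :=
  \sum_(i < n) c i *: x i.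

Definition l1norm n (c : nat -> R) : R := \sum_(i < n) `|c i|.

(** The error is additive in the coefficients, not relative to the norm. Moving the
    entries of a tuple a little then keeps it almost isometric even when its
    entries are linearly dependent. *)
Definition sim n (d : R) V W (x : nat -> V) (y : nat -> W) :=
  forall c, `| `|lc n c x| - `|lc n c y| | <= d * l1norm n c.

Definition cat_seq T m (x y : nat -> T) i := if (i < m)%N then x i else y (i - m)%N.

Lemma cat_seql T m (x y : nat -> T) i : (i < m)%N -> cat_seq m x y i = x i.
Proof. by rewrite /cat_seq => ->. Qed.

Lemma cat_seqr T m (x y : nat -> T) i : cat_seq m x y (m + i) = y i.
Proof. by rewrite /cat_seq ltnNge leq_addr /= addKn. Qed.

Lemma l1norm_ge0 n c : 0 <= l1norm n c.
Proof. by apply: sumr_ge0. Qed.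

Lemma eq_lc (V : lmodType R) n c (x y : nat -> V) :
  (forall i, (i < n)%N -> x i = y i) -> lc n c x = lc n c y.
Proof. by move=> xy; apply: eq_bigr => i _; rewrite xy. Qed.

Lemma lc_map (V W : lmodType R) (f : {linear V -> W}) n c x :
  lc n c (f \o x) = f (lc n c x).
Proof. by rewrite linear_sum; apply: eq_bigr => i _; rewrite linearZ. Qed.

Lemma lc_widen (V : lmodType R) n p c (x : nat -> V) : (n <= p)%N ->
  lc n c x = lc p (fun i => if (i < n)%N then c i else 0) x.
Proof.
move=> np; rewrite /lc (big_ord_widen _ (fun i => c i *: x i) np) big_mkcond.
by apply: eq_bigr => i _; case: ifP; rewrite ?scale0r.
Qed.

Lemma lcB (V : lmodType R) n c d (x : nat -> V) :
  lc n (fun i => c i - d i) x = lc n c x - lc n d x.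
Proof.
by rewrite /lc -sumrB; apply: eq_bigr => i _; rewrite scalerBl.
Qed.

Lemma lc_linear (V : lmodType R) n (a : R) c d (x : nat -> V) :
  lc n (fun i => a * c i + d i) x = a *: lc n c x + lc n d x.
Proof.
rewrite /lc scaler_sumr -big_split; apply: eq_bigr => i _ /=.
by rewrite scalerDl scalerA.
Qed.

Lemma lc1 (V : lmodType R) n k (x : nat -> V) : (k < n)%N ->
  lc n (fun j => (k == j)%:R) x = x k.
Proof.
move=> kn; rewrite /lc (bigD1 (Ordinal kn)) //= eqxx scale1r big1 ?addr0// => i.
by rewrite -val_eqE /= eq_sym => /negbTE ->; rewrite scale0r.
Qed.

Lemma dist_lc_le V n c (x y : nat -> V) (d : R) :
  (forall i, (i < n)%N -> `|x i - y i| <= d) ->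
  `|lc n c x - lc n c y| <= d * l1norm n c.
Proof.
move=> xy; rewrite /lc -sumrB (le_trans (ler_norm_sum _ _ _))// mulr_sumr.
by apply: ler_sum => i _; rewrite -scalerBr normrZ mulrC ler_wpM2r// xy.
Qed.

Lemma sim_eql n d V W (x x' : nat -> V) (y : nat -> W) :
  (forall i, (i < n)%N -> x i = x' i) -> sim n d x y -> sim n d x' y.
Proof. by move=> xx xy c; rewrite -(eq_lc c xx). Qed.

Lemma sim_refl n V (x : nat -> V) : sim n 0 x x.
Proof. by move=> c; rewrite subrr normr0 mul0r. Qed.

Lemma sim_eq n V (x x' : nat -> V) :
  (forall i, (i < n)%N -> x i = x' i) -> sim n 0 x x'.
Proof. by move=> xx c; rewrite (eq_lc c xx) subrr normr0 mul0r. Qed.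

Lemma sim_sym n d V W (x : nat -> V) (y : nat -> W) : sim n d x y -> sim n d y x.
Proof. by move=> xy c; rewrite distrC. Qed.

Lemma sim_trans n d e U V W (x : nat -> U) (y : nat -> V) (z : nat -> W) :
  sim n d x y -> sim n e y z -> sim n (d + e) x z.
Proof.
move=> xy yz c; rewrite mulrDl (le_trans (ler_distD `|lc n c y| _ _))//.
by rewrite lerD.
Qed.

Lemma sim_trans0l n d U V W (x : nat -> U) (y : nat -> V) (z : nat -> W) :
  sim n 0 x y -> sim n d y z -> sim n d x z.
Proof. by move=> xy /(sim_trans xy); rewrite add0r. Qed.

Lemma sim_trans0r n d U V W (x : nat -> U) (y : nat -> V) (z : nat -> W) :
  sim n d x y -> sim n 0 y z -> sim n d x z.
Proof. by move=> xy /(sim_trans xy); rewrite addr0. Qed.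

Lemma sim_le n d e V W (x : nat -> V) (y : nat -> W) :
  d <= e -> sim n d x y -> sim n e x y.
Proof. by move=> de xy c; rewrite (le_trans (xy c))// ler_wpM2r// l1norm_ge0. Qed.

Lemma sim_near n d V (x y : nat -> V) :
  (forall i, (i < n)%N -> `|x i - y i| <= d) -> sim n d x y.
Proof.
by move=> xy c; rewrite (le_trans (ler_dist_dist _ _))// dist_lc_le.
Qed.

Lemma sim0P n V W (x : nat -> V) (y : nat -> W) : sim n 0 x y ->
  forall c, `|lc n c x| = `|lc n c y|.
Proof.
by move=> xy c; have := xy c; rewrite mul0r normr_le0 subr_eq0 => /eqP.
Qed.

Lemma sim_iso n V W (f : {linear V -> W}) (x : nat -> V) :
  (forall v, `|f v| = `|v|) -> sim n 0 (f \o x) x.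
Proof. by move=> f1 c; rewrite lc_map f1 subrr normr0 mul0r. Qed.

(** A combination of the entries of [x \o f] is a combination of the entries of
    [x] whose coefficients are no larger in l1 norm, so every relation between
    tuples of the form [sim] passes to subtuples, in any order and with
    repetitions. *)
Lemma lc_reindex n m (f : nat -> nat) (c : nat -> R) :
  (forall i, (i < m)%N -> (f i < n)%N) ->
  exists2 c', l1norm n c' <= l1norm m c &
    forall (V : lmodType R) (x : nat -> V), lc m c (x \o f) = lc n c' x.
Proof.
move=> fn; exists (fun j => \sum_(i < m) c i * (f i == j)%:R).
  rewrite /l1norm (@le_trans _ _
    (\sum_(j < n) \sum_(i < m) `|c i| * (f i == j)%:R))//.
    apply: ler_sum => j _; rewrite (le_trans (ler_norm_sum _ _ _))//.
    by apply: ler_sum => i _; rewrite normrM normr_nat.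
  rewrite exchange_big /=; apply: ler_sum => i _.
  rewrite -mulr_sumr (bigD1 (Ordinal (fn _ (ltn_ord i)))) //= eqxx big1 ?addr0.
    by rewrite mulr1.
  by move=> j; rewrite -val_eqE /= eq_sym => /negbTE ->.
move=> V x; rewrite /lc.
under [RHS]eq_bigr do rewrite scaler_suml.
rewrite exchange_big /=; apply: eq_bigr => i _.
rewrite -{1}(lc1 x (fn _ (ltn_ord i))) /lc scaler_sumr.
by apply: eq_bigr => j _; rewrite scalerA.
Qed.

Lemma sim_reindex n m d V W (x : nat -> V) (y : nat -> W) (f : nat -> nat) :
  0 <= d -> (forall i, (i < m)%N -> (f i < n)%N) -> sim n d x y ->
  sim m d (x \o f) (y \o f).
Proof.
move=> d0 fn xy c; have [c' cc' c'E] := lc_reindex c fn.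
by rewrite !c'E (le_trans (xy c'))// ler_wpM2l.
Qed.

Lemma sim_widen n m d V W (x : nat -> V) (y : nat -> W) :
  0 <= d -> (m <= n)%N -> sim n d x y -> sim m d x y.
Proof.
move=> d0 mn xy; apply: (@sim_reindex n m d V W x y id) => // i im.
exact: leq_trans mn.
Qed.

Lemma sim_shift n q m d V W (x : nat -> V) (y : nat -> W) :
  0 <= d -> (q + m <= n)%N -> sim n d x y ->
  sim m d (fun i => x (q + i)%N) (fun i => y (q + i)%N).
Proof.
move=> d0 mn xy; apply: (@sim_reindex n m d V W x y (addn q)) => // i im.
by apply: leq_trans mn; rewrite ltn_add2l.
Qed.

(** The defect of a linear relation between entries of a tuple is the norm of a
    combination, so it passes to almost isometric tuples. *)
Lemma sim_relation n d V W (x : nat -> V) (y : nat -> W) i N f (a : nat -> R) :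
  0 <= d -> (i < n)%N -> (forall j, (j < N)%N -> (f j < n)%N) -> sim n d x y ->
  `|x i - lc N a (x \o f)| <= `|y i - lc N a (y \o f)| + d * (1 + l1norm N a).
Proof.
move=> d0 ni fn xy.
pose g j := if j is j'.+1 then f j' else i.
pose b (j : nat) : R := if j is j'.+1 then - a j' else 1.
have E (U : normedModType R) (z : nat -> U) :
    lc N.+1 b (z \o g) = z i - lc N a (z \o f).
  rewrite /lc big_ord_recl /= scale1r; congr (_ + _).
  by rewrite -sumrN; apply: eq_bigr => j _; rewrite scaleNr.
have gn j : (j < N.+1)%N -> (g j < n)%N by case: j => //= j; exact: fn.
have := sim_reindex d0 gn xy b; rewrite !E.
rewrite ler_norml => /andP[_].
rewrite lerBlDl; suff -> : l1norm N.+1 b = 1 + l1norm N a by [].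
rewrite /l1norm big_ord_recl normr1; congr (_ + _).
by apply: eq_bigr => j _; rewrite normrN.
Qed.

Lemma sim_dist n d V W (x : nat -> V) (y : nat -> W) i j :
  0 <= d -> (i < n)%N -> (j < n)%N -> sim n d x y ->
  `|x i - x j| <= `|y i - y j| + d * 2.
Proof.
move=> d0 ni nj xy.
have := @sim_relation n d V W x y i 1 (fun=> j) (fun=> 1) d0 ni (fun _ _ => nj) xy.
by rewrite /lc /l1norm !big_ord1 /= !scale1r normr1 -[1 + 1]/(2%:R).
Qed.

Lemma sim_relation0 n V W (x : nat -> V) (y : nat -> W) i N f (a : nat -> R) :
  (i < n)%N -> (forall j, (j < N)%N -> (f j < n)%N) -> sim n 0 x y ->
  y i = lc N a (y \o f) -> x i = lc N a (x \o f).
Proof.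
move=> ni fn xy yE; have := sim_relation a (lexx 0) ni fn xy.
by rewrite {1}yE subrr normr0 mul0r addr0 normr_le0 subr_eq0 => /eqP.
Qed.

End tuples.

(** * Completeness and compactness in terms of tuples *)

Section completeness.
Context {R : realType}.

Definition pow2 (k : nat) : R := 2^-1 ^+ k.

Lemma pow2_gt0 k : 0 < pow2 k.
Proof. by rewrite exprn_gt0// invr_gt0. Qed.

Lemma pow2S k : pow2 k = pow2 k.+1 + pow2 k.+1.
Proof. by rewrite /pow2 exprS; field. Qed.

Lemma pow2_small (e : R) : 0 < e -> exists N, forall k, (N <= k)%N -> pow2 k < e.
Proof.
move=> e0.
have /cvgrPdist_lt/(_ _ e0)[N _ NP] : pow2 @ \oo --> (0 : R).
  by apply: cvg_expr; rewrite ger0_norm ?invr_ge0// invf_lt1// ltr1n.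
exists N => k /NP; rewrite sub0r normrN ger0_norm//; exact/ltW/pow2_gt0.
Qed.

Lemma pow2_telescope (V : normedModType R) (u : nat -> V) N :
  (forall k, (N <= k)%N -> `|u k.+1 - u k| <= pow2 k) ->
  forall k j, (N <= k)%N -> `|u (k + j)%N - u k| <= pow2 k + pow2 k.
Proof.
move=> uP k j Nk.
suff : `|u (k + j)%N - u k| <= pow2 k + pow2 k - (pow2 (k + j) + pow2 (k + j)).
  by move=> /le_trans -> //; rewrite lerBlDr lerDl addr_ge0// ltW// pow2_gt0.
elim: j => [|j IH]; first by rewrite addn0 !subrr normr0.
rewrite addnS (le_trans (ler_distD (u (k + j)%N) _ _))//.
have := lerD (uP (k + j)%N (leq_trans Nk (leq_addr _ _))) IH.
by move=> /le_trans; apply; rewrite (pow2S (k + j)); lra.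
Qed.

Lemma pow2_cauchy_cvg (V : completeNormedModType R) (u : nat -> V) N :
  (forall k, (N <= k)%N -> `|u k.+1 - u k| <= pow2 k) ->
  exists l, forall k, (N <= k)%N -> `|l - u k| <= pow2 k + pow2 k.
Proof.
move=> /pow2_telescope uP.
have /cvg_ex[/= l ul] : cvg (u @ \oo).
  apply/cauchy_cvgP/cauchy_exP => e e0.
  have [M MP] := @pow2_small (e / 2) ltac:(by rewrite divr_gt0).
  exists (u (M + N)%N); exists (M + N)%N => // k /= MNk.
  rewrite -ball_normE /= distrC -(subnKC MNk).
  rewrite (le_lt_trans (uP (M + N)%N _ (leq_addl _ _)))// (splitr e).
  by rewrite ltrD// MP// leq_addr.
exists l => k Nk; apply/ler_addgt0Pl => e e0.
have /cvgrPdist_lt/(_ _ e0)[K _ KP] := ul.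
have Kk : (K <= k + K)%N by rewrite leq_addl.
rewrite (le_trans (ler_distD (u (k + K)%N) _ _))// lerD ?uP//.
exact/ltW/KP.
Qed.

End completeness.

Section orbit_quotients.
Context {R : realType} {M : metricType R} (G : isometric_action M).

Definition orbit_class (x : M) : orbit_quotient G :=
  exist _ (orbit_closure G x) (ex_intro _ x erefl).

Lemma orbit_class_surj A : exists x, A = orbit_class x.
Proof. by case: A => A [x Ax]; exists x; apply: eq_exist. Qed.

Lemma orbit_class_dist_le x y : orbit_dist (orbit_class x) (orbit_class y) <= mdist x y.
Proof. by apply: orbit_dist_le; exact: orbit_closure_refl. Qed.

Lemma orbit_class_act g x : act_maps G g -> orbit_class (g x) = orbit_class x.
Proof.
move=> Gg; apply: orbit_dist_eq0; apply/eqP; rewrite eq_le; apply/andP; split.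
  rewrite -(mdistxx (g x)); apply: orbit_dist_le; first exact: orbit_closure_refl.
  by apply: orbit_closure_act => //; exact: orbit_closure_refl.
by rewrite leNgt; apply/negP => /orbit_dist_lt[z [w [_ _]]]; rewrite ltNge mdist_ge0.
Qed.

Lemma orbit_class_dist_lt x y (e : R) : orbit_dist (orbit_class x) (orbit_class y) < e ->
  exists2 g, act_maps G g & mdist x (g y) < e.
Proof.
move=> /orbit_dist_lt[z [w [/= xz yw zw]]].
have h0 : 0 < (e - mdist z w) / 2 by rewrite divr_gt0// subr_gt0.
have [g Gg xgz] := orbit_closure_near xz (@orbit_closure_refl _ _ G x) h0.
have [h Gh why] := orbit_closure_near (@orbit_closure_refl _ _ G y) yw h0.
exists (g \o h); first exact: act_comp.
apply: le_lt_trans (metric_triangle _ (g z) _) _.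
apply: le_lt_trans (lerD (lexx _) (metric_triangle _ (g w) _)) _.
by rewrite !(act_dist Gg); lra.
Qed.

End orbit_quotients.

Lemma Iso_comp (R : realType) (X : normedModType R) (T S : {linear X -> X}) :
  Iso X T -> Iso X S -> Iso X (T \o S).
Proof.
move=> [T1 TT] [S1 SS]; split=> [x /=|]; first by rewrite T1.
apply/seteqP; split => // y _.
have [x _ <-] : range T y by rewrite TT.
have [w _ <-] : range S x by rewrite SS.
by exists w.
Qed.

(** The two ways in which compactness of the quotients of X by its isometries is
    used: a tuple almost isometric to a given one is close to an isometric one,
    and bounded tuples have finite nets up to isometries of X. *)
Section orbit_compactness.
Context {R : realType} (X : normedModType R).
Hypothesis cptX : forall n, compact [set: orbit_quotient (Iso_action X n)].

Lemma orbit_cluster n (y : nat -> ball_tuple X n) :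
  exists z : ball_tuple X n, forall (e : R) K, 0 < e ->
  exists2 k, (K <= k)%N &
    exists2 T, Iso X T & forall i, `|sval z i - T (sval (y k) i)| < e.
Proof.
have [|A [_ AP]] := @cptX n (orbit_class _ \o y @ \oo) _; first exact: filterT.
have [z Az] := orbit_class_surj A; exists z => e K e0; rewrite Az in AP.
pose late := [set orbit_class (Iso_action X n) (y k) | k in [set k | (K <= k)%N]].
have [] := AP late _ _ (nbhsx_ballx _ _ e0).
  by exists K => // k Kk; exists k.
move=> _ [[k /= Kk <-]]; rewrite ballEmdist /= => /orbit_class_dist_lt[g [T TI gT] zgy].
exists k => //; exists T => // i; rewrite -gT.
exact: le_lt_trans (le_ball_tuple_dist z (g (y k)) i) zgy.
Qed.

Lemma tuple_cluster n (C : R) (y : nat -> nat -> X) : 0 < C ->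
  (forall k i, (i < n)%N -> `|y k i| <= C) ->
  exists z : nat -> X, forall (e : R) K, 0 < e ->
  exists2 k, (K <= k)%N &
    exists2 T, Iso X T & forall i, (i < n)%N -> `|z i - T (y k i)| < e.
Proof.
move=> C0 yC.
have y1 k (i : 'I_n) : `|C^-1 *: y k i| <= 1.
  by rewrite normrZ gtr0_norm ?invr_gt0// mulrC ler_pdivrMr// mul1r yC.
have [z zP] := orbit_cluster (fun k =>
  exist (fun x : 'I_n -> X => forall i, `|x i| <= 1) (fun i => C^-1 *: y k i) (y1 k)).
exists (fun i => if insub i is Some i' then C *: sval z i' else 0) => e K e0.
have [k Kk [T TI Tz]] := zP (e / C) K (divr_gt0 e0 C0).
exists k => //; exists T => // i ni; rewrite insubT.
have := Tz (Ordinal ni); rewrite /= ltr_pdivlMr// mulrC.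
rewrite -{1}(gtr0_norm C0) -normrZ scalerBr [T (_ *: _)]linearZ /= scalerA.
by rewrite divff ?gt_eqF// scale1r.
Qed.

(** Otherwise a sequence of ever better almost isometric tuples would stay away
    from all isometric ones; but a cluster point of their orbits is isometric. *)
Lemma sim0_of_sim n (V : normedModType R) (x : nat -> V) (e : R) : 0 < e ->
  exists2 d : R, 0 < d & forall y : nat -> X, sim n d y x ->
    exists2 y' : nat -> X, sim n 0 y' x & forall i, (i < n)%N -> `|y i - y' i| < e.
Proof.
move=> e0; apply: contrapT => nd.
have badP k : exists y : nat -> X, sim n (pow2 k : R) y x /\
    ~ exists2 y' : nat -> X, sim n 0 y' x & forall i, (i < n)%N -> `|y i - y' i| < e.
  apply: contrapT => nk; apply: nd; exists (pow2 k); first exact: pow2_gt0.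
  by move=> y yx; apply: contrapT => ny; apply: nk; exists y.
have [y yP] := choice badP.
pose C := \sum_(i < n) `|x i| + 1.
have C0 : 0 < C by rewrite ltr_wpDl// sumr_ge0.
have yC k i : (i < n)%N -> `|y k i| <= C.
  move=> ni; have [yx _] := yP k; have := yx (fun j => (i == j)%:R).
  rewrite !lc1// (_ : l1norm n _ = 1); last first.
    rewrite /l1norm (bigD1 (Ordinal ni))//= eqxx normr1 big1 ?addr0// => j.
    by rewrite -val_eqE /= eq_sym => /negbTE ->; rewrite normr0.
  rewrite mulr1 ler_distl => /andP[_ /le_trans]; apply; apply: lerD.
    by rewrite (bigD1 (Ordinal ni))//= lerDl sumr_ge0.
  by rewrite exprn_ile1// ?invr_ge0// invf_le1// ler1n.
have [z zP] := tuple_cluster C0 yC.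
have zx : sim n 0 z x.
  move=> c; rewrite mul0r; apply/ler_addgt0Pl => h h0; rewrite addr0.
  have L0 : 0 < 2 * (l1norm n c + 1) by rewrite mulr_gt0// ltr_wpDl// l1norm_ge0.
  have [K KP] := pow2_small (divr_gt0 h0 L0).
  have [k Kk [T [T1 _] Tz]] := zP _ K (divr_gt0 h0 L0).
  have [yx _] := yP k.
  have zTy : sim n (h / (2 * (l1norm n c + 1))) z (T \o y k).
    by apply: sim_near => i ni; exact/ltW/Tz.
  have Tyx : sim n (h / (2 * (l1norm n c + 1))) (T \o y k) x.
    apply: sim_trans0l (sim_iso _ _ T1) _; apply: sim_le yx.
    exact/ltW/KP.
  have := sim_trans zTy Tyx c => /le_trans; apply.
  have q0 := divr_gt0 h0 L0; rewrite -[leRHS](divfK (lt0r_neq0 L0)).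
  by move: (h / _) q0 => t; lra.
have [p _ [T TI Tz]] := zP e 0%N e0.
have [yx] := yP p; apply.
have [S [[S1 SS] TS _]] := Iso_inv TI; have [T1 _] := TI.
exists (S \o z); first exact: sim_trans0l (sim_iso _ _ S1) zx.
move=> i ni /=; rewrite -{1}(TS (y p i)) -linearB S1 distrC; exact: Tz.
Qed.

Definition orbit_net n (C e : R) (s : seq (nat -> X)) :=
  forall y : nat -> X, (forall i, (i < n)%N -> `|y i| <= C) ->
  exists2 j, (j < size s)%N & exists2 T, Iso X T &
    forall i, (i < n)%N -> `|T (y i) - nth y s j i| < e.

(** Without a net, choosing tuples greedily gives a sequence whose orbits are
    pairwise far apart, and it has no cluster point. *)
Lemma orbit_net_exists n (C e : R) : 0 < e -> exists s, orbit_net n C e s.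
Proof.
move=> e0; apply: contrapT => /forallNP noN.
pose D := Num.max C 1; have D0 : 0 < D by rewrite lt_max ltr01 orbT.
have /choice[F FP] s : exists y : nat -> X,
    (forall i, (i < n)%N -> `|y i| <= C) /\
    ~ exists2 j, (j < size s)%N & exists2 T, Iso X T &
      forall i, (i < n)%N -> `|T (y i) - nth y s j i| < e.
  have /existsNP[y /not_implyP[yC yN]] := noN s.
  by exists y.
pose L := fix L k := if k is k'.+1 then F (L k') :: L k' else [::].
pose y k := F (L k).
have sizeL k : size (L k) = k by elim: k => //= k ->.
have nthL y0 j k : (j < k)%N -> nth y0 (L k) (k.-1 - j)%N = y j.
  elim: k => //= k IH; rewrite ltnS leq_eqVlt => /orP[/eqP->|jk].
    by rewrite subnn.
  have -> : (k - j = (k.-1 - j).+1)%N by lia.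
  exact: IH.
have yD k i : (i < n)%N -> `|y k i| <= D.
  by move=> ni; rewrite le_max (FP (L k)).1.
have e20 : 0 < e / 2 by rewrite divr_gt0.
have [z zP] := tuple_cluster D0 yD.
have [j _ [T TI zT]] := zP _ 0%N e20.
have [k jk [S SI zS]] := zP _ j.+1 e20.
have [T' [TI' TT' T'T]] := Iso_inv TI.
apply: (FP (L k)).2; exists (k.-1 - j)%N; first by rewrite sizeL; lia.
exists (T' \o S); first exact: Iso_comp.
move=> i ni; rewrite nthL//= -TI.1 linearB T'T.
rewrite (le_lt_trans (ler_distD (z i) _ _))// (splitr e) ltrD ?zT//.
by rewrite distrC zS.
Qed.

End orbit_compactness.

(** * Guards *)

Section guards.
Context {R : realType} (X : normedModType R).

(** [y] of length [m] guards its first [n] entries. The condition depends on the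
    norms of combinations of [y] only, since it quantifies over all isometric
    copies [y'] of [y]; this is what lets guards survive when the tuples of a
    chain are moved. *)
Definition guarded n m (e d : R) (y : nat -> X) :=
  forall (y' : nat -> X) p (z : nat -> X), sim m 0 y' y -> (m <= p)%N -> sim m d z y' ->
  exists2 z' : nat -> X, sim p 0 z' z & forall i, (i < n)%N -> `|z' i - y' i| < e.

Lemma guarded_sim n m e d (y w : nat -> X) :
  sim m 0 w y -> guarded n m e d y -> guarded n m e d w.
Proof.
move=> wy gy y' p z y'w mp zy'; apply: (gy y' p z) => //.
exact: sim_trans0l y'w wy.
Qed.

Lemma guarded_le n m n' e e' d d' (y : nat -> X) : (n' <= n)%N -> e <= e' ->
  d' <= d -> guarded n m e d y -> guarded n' m e' d' y.
Proof.
move=> nn ee dd gy y' p z y'y mp /(sim_le dd) zy'.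
have [z' z'z z'y'] := gy y' p z y'y mp zy'; exists z' => // i ni.
by apply: lt_le_trans ee; apply: z'y'; apply: leq_trans nn.
Qed.

Hypothesis cptX : forall n, compact [set: orbit_quotient (Iso_action X n)].

(** Among all isometric extensions [y] of [x], take one for which the isometric
    copies of [y] meet, in their first [n] entries, the fewest balls of a finite
    net of the [n]-tuples up to isometries of [X]. A further extension [u] of [y]
    then meets the very same balls, so each copy of [y] is close on its first
    [n] entries to the image of a copy of [u] by an isometry of [X]. *)
Lemma guarded_exists n (x : nat -> X) (e : R) : 0 < e ->
  exists (m : nat) (y : nat -> X) (d : R),
    [/\ (n <= m)%N, sim n 0 y x, 0 < d & guarded n m e d y].
Proof.
move=> e0; pose r := e / 3; have r0 : 0 < r by rewrite divr_gt0.
have [s sP] := orbit_net_exists cptX n (\sum_(i < n) `|x i|) r0.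
pose meets m (y : nat -> X) (j : 'I_(size s)) := exists2 w : nat -> X,
  sim m 0 w y & forall i, (i < n)%N -> `|w i - nth x s j i| < r.
pose M m y := [set j : 'I_(size s) | `[< meets m y j >]]%SET.
have [k [[m [y [nm yx <-]]] kmin]] : exists k, (exists m y,
      [/\ (n <= m)%N, sim n 0 y x & #|M m y| = k]) /\
    forall m y, (n <= m)%N -> sim n 0 y x -> (k <= #|M m y|)%N.
  pose P k := `[< exists m y, [/\ (n <= m)%N, sim n 0 y x & #|M m y| = k] >].
  have exP : exists k, P k.
    by exists #|M n x|; apply/asboolP; exists n, x; split => //; exact: sim_refl.
  exists (ex_minn exP); case: ex_minnP => k /asboolP kP kmin; split=> // m y nm yx.
  by apply: kmin; apply/asboolP; exists m, y.
have [d d0 dP] := sim0_of_sim cptX m y r0.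
exists m, y, d; split => // y' p z y'y mp zy'.
have [v vy zv] := dP z (sim_trans0r zy' y'y).
pose u := cat_seq m v z.
have uv : sim m 0 u v by apply: sim_eq => i im; rewrite /u cat_seql.
have uy : sim m 0 u y by exact: sim_trans0l vy.
have wM (w : nat -> X) : sim (m + p) 0 w u -> sim m 0 w y.
  by move=> /(sim_widen (lexx 0) (leq_addr p m)) wu; exact: sim_trans0l uy.
have eqM : M (m + p)%N u = M m y.
  apply/eqP; rewrite eqEcard; apply/andP; split.
    apply/fintype.subsetP => j; rewrite !inE => -[w wu wj].
    by exists w => //; exact: wM.
  apply: kmin; first exact: leq_trans (leq_addr _ _).
  exact: sim_trans0l (sim_widen (lexx 0) nm uy) yx.
have y'x : sim n 0 y' x := sim_trans0l (sim_widen (lexx 0) nm y'y) yx.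
have [i ni|j js [T TI]] := sP y'.
  have := sim0P y'x (fun j => (i == j)%:R); rewrite !lc1// => ->.
  by rewrite (bigD1 (Ordinal ni))//= lerDl sumr_ge0.
rewrite (set_nth_default x)// => Ty'; have : Ordinal js \in M m y.
  rewrite inE; apply/asboolP; exists (T \o y').
    exact: (sim_trans0l (sim_iso m y' TI.1) y'y).
  exact: Ty'.
rewrite -eqM inE => /asboolP[w wu wj].
have [S [SI TS ST]] := Iso_inv TI.
exists (S \o (fun i => w (m + i)%N)).
  apply: sim_trans0l (sim_iso _ _ SI.1) _.
  apply: (sim_trans0r (sim_shift (lexx 0) (leqnn (m + p)) wu)).
  by apply: sim_eq => i _; rewrite /u cat_seqr.
move=> i ni; rewrite /= -TI.1 linearB ST.
have ip : (i < p)%N by lia.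
have h1 : `|w (m + i)%N - w i| < r.
  have := sim_dist (lexx 0) (_ : (m + i < m + p)%N) (_ : (i < m + p)%N) wu.
  rewrite mul0r addr0 => /(_ _ _)/le_lt_trans -> //; try lia.
  by rewrite /u cat_seqr cat_seql ?zv//; lia.
have h2 := wj i ni; have h3 := Ty' i ni.
have h4 := ler_distD (w i) (w (m + i)%N) (T (y' i)).
have h5 := ler_distD (nth x s j i) (w i) (T (y' i)).
rewrite [`|nth x s j i - _|]distrC in h5.
have : e = 3 * r by rewrite /r; field.
by rewrite /= in h2; lra.
Qed.

End guards.

(** * Finite-dimensional spaces and tuples *)

Section independence.
Context {R : realType}.

Definition independent (V : lmodType R) n (x : nat -> V) :=
  forall c, lc n c x = 0 -> forall i, (i < n)%N -> c i = 0.

Lemma independent_le (V : lmodType R) n m (x y : nat -> V) :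
  independent n x -> (forall i, (i < n)%N -> exists c, x i = lc m c y) ->
  (n <= m)%N.
Proof.
move=> xi xy; rewrite leqNgt; apply/negP => mn.
have /choice[a aP] (i : 'I_n) : exists c, x i = lc m c y by exact: xy.
pose A := \matrix_(i < n, j < m) a i j.
have : kermx A != 0.
  rewrite -mxrank_eq0 mxrank_ker -lt0n subn_gt0.
  exact: leq_ltn_trans (rank_leq_col _) mn.
move=> /rowV0Pn[u /sub_kermxP uA u0].
pose c i := if insub i is Some i' then u 0 i' else 0.
have cE (i : 'I_n) : c i = u 0 i by rewrite /c valK.
suff u00 : u = 0 by rewrite u00 eqxx in u0.
apply/rowP => i; rewrite mxE -cE; apply: xi => //.
rewrite /lc; under eq_bigr do rewrite cE aP /lc scaler_sumr.
rewrite exchange_big /= big1// => j _.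
under eq_bigr do rewrite scalerA.
rewrite -scaler_suml; have := congr1 (fun B : 'rV[R]_m => B 0 j) uA; rewrite !mxE.
by under eq_bigr do rewrite mxE; move=> ->; rewrite scale0r.
Qed.

Lemma independentS (V : lmodType R) n (x : nat -> V) :
  independent n x -> ~ (exists c, x n = lc n c x) -> independent n.+1 x.
Proof.
move=> xi xn c; rewrite /lc big_ord_recr /= -/(lc n c x) => c0.
have cn : c n = 0.
  apply: contrapT => /eqP cn; apply: xn.
  exists (fun i => - (c n)^-1 * c i).
  have -> : lc n (fun i => - (c n)^-1 * c i) x = - (c n)^-1 *: lc n c x.
    by rewrite /lc scaler_sumr; apply: eq_bigr => i _; rewrite scalerA.
  move/eqP: c0; rewrite addr_eq0 => /eqP ->.
  by rewrite scalerN scaleNr opprK scalerA mulVf// scale1r.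
move: c0; rewrite cn scale0r addr0 => /xi cP i.
by rewrite ltnS leq_eqVlt => /orP[/eqP->//|/cP].
Qed.

Lemma eq_independent (V : lmodType R) n (x y : nat -> V) :
  (forall i, (i < n)%N -> x i = y i) -> independent n x -> independent n y.
Proof. by move=> xy xi c; rewrite -(eq_lc c xy) => /xi. Qed.

Lemma independent_basis (V : lmodType R) m (x : nat -> V) :
  exists d f, [/\ independent d (x \o f),
    forall i, (i < d)%N -> (f i < m)%N &
    forall i, (i < m)%N -> exists c, x i = lc d c (x \o f)].
Proof.
elim: m => [|m [d [f [fi fm fx]]]].
  by exists 0%N, id; split => // c _ i.
have [[c cE]|nc] := pselect (exists c, x m = lc d c (x \o f)).
  exists d, f; split => // [i /fm /ltnW //|i].
  by rewrite ltnS leq_eqVlt => /orP[/eqP->|/fx//]; exists c.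
pose g i := if (i < d)%N then f i else m.
have gf i : (i < d)%N -> (x \o f) i = (x \o g) i by rewrite /g/= => ->.
exists d.+1, g; split => [|i|i].
- apply: independentS; first exact: eq_independent fi.
  move=> [c]; rewrite -(eq_lc c gf) /= /g ltnn => cE; apply: nc.
  by exists c.
- by move=> _; rewrite /g; case: ifP => [/fm/ltnW|].
- rewrite ltnS leq_eqVlt => /orP[/eqP->|/fx[c ->]].
    exists (fun j => (d == j)%:R); rewrite lc1//= /g ltnn//.
  exists (fun j => if (j < d)%N then c j else 0).
  by rewrite -(lc_widen _ _ (leqnSn d)); exact: eq_lc.
Qed.

Lemma infinite_dimensional_independent (V : normedModType R) :
  infinite_dimensional V -> forall n, exists x : nat -> V, independent n x.
Proof.
move=> Vi; elim=> [|n [x xi]]; first by exists (fun=> 0) => c _ i.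
have [v vP] : exists v, ~ exists c, v = lc n c x.
  apply/existsNP => all_lc; apply: Vi; exists n, (fun i => x i).
  apply/seteqP; split => // v _; have [c ->] := all_lc v.
  by exists (fun i : 'I_n => c i).
exists (cat_seq n x (fun=> v)); apply: independentS.
  by apply: eq_independent xi => i ni; rewrite cat_seql.
move=> [c cE]; apply: vP; exists c.
have := @cat_seqr V n x (fun=> v) 0; rewrite addn0 => {1}<-; rewrite cE.
by apply: eq_lc => i ni; rewrite cat_seql.
Qed.

End independence.

Section linear_maps.
Context {R : realType}.
Implicit Types (V W : normedModType R) (E F : fdspace R).

Lemma linear_mk (U V : lmodType R) (f : U -> V) : linear f ->
  exists g : {linear U -> V}, forall x, g x = f x.
Proof.
move=> fl; pose g : {linear U -> V} := HB.pack f (GRing.isLinear.Build _ _ _ _ f fl).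
by exists g.
Qed.

(** Subspaces given as ranges of isometries [J] are compared by factoring maps
    through [J]. *)
Lemma linear_factor (U : lmodType R) V W (J : {linear V -> W}) (A : {linear U -> W}) :
  (forall v, `|J v| = `|v|) -> (forall u, exists v, J v = A u) ->
  exists phi : {linear U -> V}, forall u, J (phi u) = A u.
Proof.
move=> J1 /choice[f fP].
have Jinj v w : J v = J w -> v = w.
  by move=> vw; apply/eqP; rewrite -subr_eq0 -normr_eq0 -J1 linearB vw subrr normr0.
have [phi phiE] : exists g : {linear U -> V}, forall x, g x = f x.
  by apply: linear_mk => a u v; apply: Jinj; rewrite linearP !fP linearP.
by exists phi => u; rewrite phiE.
Qed.

(** Coordinates and basis are indexed by [nat], with value 0 outside the dimension,
    so that the basis is a tuple in the same sense as the others. *)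
Definition coord E (v : E) (i : nat) : R :=
  if insub i is Some i' then (v : 'rV[R]_(fddim E)) 0 i' else 0.

Definition std_basis E (i : nat) : E :=
  if insub i is Some i' then (delta_mx 0 i' : 'rV[R]_(fddim E)) else 0.

Lemma coord_std_basis E (v : E) : v = lc (fddim E) (coord v) (@std_basis E).
Proof.
rewrite {1}[v](row_sum_delta (v : 'rV[R]_(fddim E))).
by apply: eq_bigr => i _; rewrite /coord /std_basis !valK.
Qed.

Lemma coord_lc E n (c : nat -> R) : coord (lc (fddim E) c (@std_basis E)) n =
  if (n < fddim E)%N then c n else 0.
Proof.
rewrite /coord; case: insubP => [i ni <-|/negbTE -> //]; rewrite ltn_ord.
have -> : lc (fddim E) c (@std_basis E) = \row_i c i :> 'rV[R]_(fddim E).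
  rewrite [RHS]row_sum_delta /lc; apply: eq_bigr => j _.
  by rewrite /std_basis valK mxE.
by rewrite mxE.
Qed.

Lemma independent_std_basis E : independent (fddim E) (@std_basis E).
Proof.
move=> c c0 i ni; have := coord_lc E i c; rewrite ni c0 => <-.
by rewrite /coord; case: insubP => // i' _ _; rewrite mxE.
Qed.

Lemma linear_coord E (V : lmodType R) (T : {linear E -> V}) (v : E) :
  T v = lc (fddim E) (coord v) (T \o @std_basis E).
Proof. by rewrite {1}(coord_std_basis v) -lc_map. Qed.

Lemma coordD E (a : R) (v w : E) : coord (a *: v + w) = (fun i => a * coord v i + coord w i).
Proof.
apply/funext => i; rewrite /coord; case: insubP => [i' _ _|_]; first by rewrite !mxE.
by rewrite mulr0 addr0.
Qed.

Lemma tuple_linear E (V : lmodType R) (x : nat -> V) :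
  exists T : {linear E -> V}, forall v, T v = lc (fddim E) (coord v) x.
Proof.
by apply: linear_mk => a v w; rewrite coordD lc_linear.
Qed.

Lemma tuple_linear_basis E (V : lmodType R) (x : nat -> V) (T : E -> V) :
  (forall v, T v = lc (fddim E) (coord v) x) ->
  forall i, (i < fddim E)%N -> T (@std_basis E i) = x i.
Proof.
move=> TE i ni; rewrite TE -[RHS](lc1 x ni); apply: eq_bigr => j _.
rewrite /coord /std_basis valK insubT /= mxE eqxx /=.
by congr (_%:R *: _); rewrite -val_eqE /= eq_sym.
Qed.

Lemma l1norm_coord_le E : exists2 K : R, 0 < K &
  forall v : E, l1norm (fddim E) (coord v) <= K * `|v|.
Proof.
have [K K0 KP] := fdspace_norm_equiv E.
exists ((fddim E)%:R * K + 1) => [|v].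
  by rewrite ltr_wpDl// mulr_ge0// ltW.
have vK := KP v.
rewrite /l1norm (@le_trans _ _ (\sum_(i < fddim E) K * `|v|))//.
  apply: ler_sum => i _; apply: le_trans (KP v).
  by rewrite /coord valK; exact: le_coord_mx_norm.
rewrite sumr_const card_ord -[leLHS]mulr_natl mulrDl mul1r mulrA.
by rewrite lerDl.
Qed.

(** The tuple need not be independent: the coordinates of [F] refer to a basis
    extracted from it. *)
Lemma span_fdspace V m (x : nat -> V) :
  exists (F : fdspace R) (J : {linear F -> V}), [/\ forall f, `|J f| = `|f|,
    forall i, (i < m)%N -> exists f, J f = x i &
    forall f, exists c, J f = lc m c x].
Proof.
have [d [f [fi fm fx]]] := independent_basis m x.
pose c (v : 'rV[R]_d) i := if insub i is Some i' then v 0 i' else 0 : R.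
have cD (a : R) v w : c (a *: v + w) = (fun i => a * c v i + c w i).
  apply/funext => i; rewrite /c; case: insubP => [i' _ _|_]; first by rewrite !mxE.
  by rewrite mulr0 addr0.
pose J0 v := lc d (c v) (x \o f).
have J0l : linear J0 by move=> a v w; rewrite /J0 cD lc_linear.
have [J JE] := linear_mk J0l.
have J0D v w : `|J0 (v + w)| <= `|J0 v| + `|J0 w| by rewrite -!JE linearD ler_normD.
have J0Z (a : R) v : `|J0 (a *: v)| = `|a| * `|J0 v| by rewrite -!JE linearZ normrZ.
have J00 v : `|J0 v| = 0 -> v = 0.
  move=> /normr0_eq0 /fi v0; apply/rowP => i; rewrite mxE.
  by have := v0 i (ltn_ord i); rewrite /c valK.
pose F := FdSpace J0D J0Z J00.
have [JF JFE] : exists JF : {linear F -> V}, forall v, JF v = J0 v.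
  by apply: linear_mk.
exists F, JF; split=> [v|i im|v]; first by rewrite JFE.
  have [a aE] := fx i im; exists ((\row_j a j) : 'rV[R]_d).
  rewrite JFE aE /J0; apply: eq_bigr => j _; congr (_ *: _).
  by rewrite /c valK mxE.
have [a _ aE] := lc_reindex (c v) fm.
by exists a; rewrite JFE /J0 aE.
Qed.

(** The l1 norm of the coordinates is bounded by the norm of the vector, so the
    error of [sim], measured against a basis, is relative to the norm. *)
Lemma Emb_of_sim E (d : R) : 0 < d -> exists2 h : R, 0 < h &
  forall V (z : nat -> V) (T : {linear E -> V}),
    (forall v, T v = lc (fddim E) (coord v) z) ->
    sim (fddim E) h z (@std_basis E) -> Emb d E V T.
Proof.
move=> d0; have [K K0 KP] := l1norm_coord_le E.
have e1 : 0 < 1 - expR (- d) by rewrite subr_gt0 -expR0 ltr_expR oppr_lt0.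
exists ((1 - expR (- d)) / K); first by rewrite divr_gt0.
move=> V z T TE zE v; have := zE (coord v).
rewrite -coord_std_basis -TE.
have le1 : `| `|T v| - `|v| | <= (1 - expR (- d)) / K * l1norm (fddim E) (coord v) ->
  `| `|T v| - `|v| | <= (1 - expR (- d)) * `|v|.
  move=> /le_trans; apply; rewrite -mulrA (ler_wpM2l (ltW e1))//.
  by rewrite ler_pdivrMl.
have ed : 1 + d <= expR d := expR_ge1Dx d.
have emd : 1 - d <= expR (- d) by exact: expR_ge1Dx.
move=> /le1; rewrite ler_distl => /andP[h1 h2]; apply/andP; split; first by lra.
apply: le_trans h2 _; rewrite -[X in X + _]mul1r -mulrDl ler_wpM2r//; lra.
Qed.

Lemma sim_of_Emb V m (f : nat -> V) (h : R) : 0 < h -> exists2 d : R, 0 < d &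
  forall W (i : {linear V -> W}), Emb d V W i -> sim m h (i \o f) f.
Proof.
move=> h0; pose B := \sum_(i < m) `|f i| + 1.
have B0 : 0 < B by rewrite ltr_wpDl// sumr_ge0.
exists (ln (1 + h / B)); first by rewrite ln_gt0// ltrDl divr_gt0.
have hB1 : 0 < 1 + h / B by rewrite addr_gt0// divr_gt0.
move=> W i iP c; rewrite lc_map; have := iP (lc m c f).
rewrite expRN lnK ?posrE//; set w := lc m c f => /andP[h1 h2].
have wB : `|w| <= B * l1norm m c.
  rewrite (le_trans (ler_norm_sum _ _ _))// mulr_sumr; apply: ler_sum => j _.
  rewrite normrZ mulrC ler_wpM2r//.
  by rewrite /B (bigD1 j)//= -addrA lerDl addr_ge0// sumr_ge0.
have hw : h / B * `|w| <= h * l1norm m c.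
  by rewrite -mulrA (ler_wpM2l (ltW h0))// ler_pdivrMl.
have q0 : 0 < h / B by rewrite divr_gt0.
apply: le_trans hw; rewrite ler_distl; apply/andP; split; last by lra.
apply: le_trans h1; rewrite -subr_ge0.
have -> : (1 + h / B)^-1 * `|w| - (`|w| - h / B * `|w|) =
  (h / B) ^+ 2 / (1 + h / B) * `|w| by field; rewrite !gt_eqF// addr_gt0.
by rewrite mulr_ge0// divr_ge0 ?sqr_ge0// ltW.
Qed.

End linear_maps.

(** * The age of a space *)

Section age.
Context {R : realType}.
Implicit Types (V W : normedModType R) (E F G L : fdspace R).

Lemma Emb0P V W (T : {linear V -> W}) : Emb 0 V W T <-> forall v, `|T v| = `|v|.
Proof.
split=> [T0 v|T1 v]; last by rewrite oppr0 expR0 mul1r T1 lexx.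
by have := T0 v; rewrite oppr0 expR0 mul1r -eq_le => /eqP.
Qed.

Lemma Emb_of_isometry V W (T : {linear V -> W}) (d : R) : 0 <= d ->
  (forall v, `|T v| = `|v|) -> Emb d V W T.
Proof.
move=> d0 T1 v; rewrite T1; apply/andP; split.
  by rewrite -[leRHS]mul1r ler_wpM2r// -expR0 ler_expR oppr_le0.
by rewrite -[leLHS]mul1r ler_wpM2r// -expR0 ler_expR.
Qed.

Lemma range_lc V W (J : {linear V -> W}) m (x : nat -> W) :
  (forall i, (i < m)%N -> exists v, J v = x i) ->
  forall c, exists v, J v = lc m c x.
Proof.
move=> Jx c; have /choice[f fP] (i : 'I_m) : exists v, J v = x i by exact: Jx.
exists (\sum_(i < m) c i *: f i); rewrite linear_sum; apply: eq_bigr => i _.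
by rewrite linearZ /= fP.
Qed.

Lemma span_lc V m (x : nat -> V) : Defs.span (fun i : 'I_m => x i) = range (fun c => lc m c x).
Proof.
apply/seteqP; split=> _ [c _ <-]; last by exists (fun i : 'I_m => c i).
exists (fun i => if insub i is Some i' then c i' else 0) => //.
by apply: eq_bigr => i _; rewrite valK.
Qed.

Lemma fdsub_spanE V (E : fdsubspace V) :
  exists m (x : nat -> V), fdsub_set E = range (fun c => lc m c x).
Proof.
have [m [v Ev]] := fdsub_fin E.
exists m, (fun i => if insub i is Some i' then v i' else 0); rewrite -span_lc Ev.
by congr Defs.span; apply/funext => i; rewrite valK.
Qed.

Lemma linear_fdsub_val V (E : fdsubspace V) : linear (@fdsub_val R V E).
Proof. by []. Qed.

Lemma fdsub_val_map V (E : fdsubspace V) :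
  exists J : {linear E -> V}, forall v, J v = fdsub_val v.
Proof. exact/linear_mk/linear_fdsub_val. Qed.

Lemma fdsub_mem V (E : fdsubspace V) v : fdsub_set E v -> exists w : E, fdsub_val w = v.
Proof. by move=> Ev; exists (@FdSub R V E v (asboolT Ev)). Qed.

Lemma AgeP V E : Age V E <-> exists j : {linear E -> V}, forall v, `|j v| = `|v|.
Proof.
split=> [[F [T [T1 _]]]|[j j1]].
  have [J JE] := fdsub_val_map F.
  by exists (J \o T) => v; rewrite /= JE -T1.
have fin : exists n (v : 'I_n -> V), range j = Defs.span v.
  exists (fddim E), (fun i : 'I_(fddim E) => j (@std_basis R E i)).
  rewrite (span_lc _ (j \o @std_basis R E)).
  apply/seteqP; split=> _ [v _ <-]; first by exists (coord v) => //; rewrite linear_coord.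
  by exists (lc (fddim E) v (@std_basis R E)) => //; rewrite -lc_map.
pose F := FdSubspace fin; exists F.
have [J JE] := fdsub_val_map F.
have [T TP] : exists T : {linear E -> F}, forall u, J (T u) = j u.
  apply: linear_factor => [v|u]; first by rewrite JE.
  have [|w wE] := @fdsub_mem _ F (j u); first by exists u.
  by exists w; rewrite JE.
have Tval u : fdsub_val (T u) = j u by rewrite -TP JE.
exists T; split=> [v|]; first by rewrite -j1 -Tval.
apply/seteqP; split=> // w _; have [u _ uw] := mem_fdsub w.
by exists u => //; apply: val_inj; rewrite /= Tval.
Qed.

Lemma fdsub_fdspace V (E : fdsubspace V) : exists (F : fdspace R) (T : {linear F -> E}),
  (forall v, `|T v| = `|v|) /\ range T = setT.
Proof.
have [m [x Ex]] := fdsub_spanE E.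
have [F [J0 [J1 Jx JF]]] := span_fdspace m x.
have [J JE] := fdsub_val_map E.
have [T TP] : exists T : {linear F -> E}, forall u, J (T u) = J0 u.
  apply: linear_factor => [v|u]; first by rewrite JE.
  have [|w wE] := @fdsub_mem _ E (J0 u).
    by rewrite Ex; have [c ->] := JF u; exists c.
  by exists w; rewrite JE.
exists F, T; split=> [v|]; first by rewrite -J1 -TP JE.
apply/seteqP; split=> // w _; have := mem_fdsub w; rewrite Ex => -[c _ cw].
have [u uc] := range_lc Jx c.
by exists u => //; apply: val_inj; rewrite /= -JE TP uc.
Qed.

Lemma fddim_le E F (T : {linear E -> F}) : injective T -> (fddim E <= fddim F)%N.
Proof.
move=> Tinj; apply: (@independent_le R F _ _ (T \o @std_basis R E) (@std_basis R F)).
  move=> c; rewrite lc_map => Tc0; apply: independent_std_basis.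
  by apply: Tinj; rewrite Tc0 linear0.
by move=> i _; exists (coord (T (std_basis E i))); exact: coord_std_basis.
Qed.

(** An isomorphism with small distortion, divided by its norm, is an almost
    isometric embedding; conversely an almost isometric embedding is a small
    distortion onto its range. *)
Lemma Age_cl_Emb V L : Age_cl V L <-> forall d : R, 0 < d -> Emb d L V !=set0.
Proof.
split=> [Lcl d d0|Lemb].
  have [E [/AgeP[j j1] [LE dLE]]] := Lcl _ (nbhsx_ballx L d d0).
  have [r [T [S [TS ST ->]]] rd] := inf_lt (BMdist_set_neq0 LE) dLE.
  have [[x /eqP x0]|/forallNP L0] := pselect (exists x : L, x <> 0); last first.
    have {}L0 (x : L) : x = 0 by apply: contrapT; exact: L0.
    by exists (j \o T) => v /=; rewrite (L0 v) !linear0 !normr0 !mulr0 lexx.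
  have TS1 := opnorm_cancel_ge1 x0 TS.
  have TS0 : 0 < opnorm T * opnorm S := lt_le_trans ltr01 TS1.
  have T0 : 0 < opnorm T.
    by rewrite lt_neqAle opnorm_ge0 andbT; apply: contraTneq TS0 => <-; rewrite mul0r ltxx.
  have TSd : opnorm T * opnorm S <= expR d.
    by rewrite -(lnK TS0) ler_expR ltW.
  pose t := (opnorm T)^-1.
  have [U UE] : exists U : {linear L -> V}, forall v, U v = t *: j (T v).
    by apply: linear_mk => a v w; rewrite linearP /= linearP /= scalerDr !scalerA [t * a]mulrC.
  exists U => v; rewrite UE normrZ j1 gtr0_norm ?invr_gt0// [t * _]mulrC /t.
  apply/andP; split.
    rewrite ler_pdivlMr// expRN -mulrA ler_pdivrMl ?expR_gt0//.
    have Sv : `|v| <= opnorm S * `|T v| by rewrite -{1}(TS v) le_opnorm.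
    rewrite (le_trans (ler_wpM2r (ltW T0) Sv))// mulrAC [opnorm S * _]mulrC.
    by rewrite ler_wpM2r.
  rewrite ler_pdivrMr// (le_trans (le_opnorm T v))// mulrC ler_wpM2r ?opnorm_ge0//.
  by rewrite -[leLHS]mul1r ler_wpM2r// -expR0 ler_expR ltW.
move=> B /nbhs_ballP[e /= e0 eB].
have e30 : 0 < e / 3 by rewrite divr_gt0.
have [th thP] := Lemb _ e30.
have [E [J [J1 Jx JE]]] := span_fdspace (fddim L) (th \o @std_basis R L).
have [phi phiE] : exists phi : {linear L -> E}, forall v, J (phi v) = th v.
  by apply: linear_factor => // u; rewrite linear_coord; exact: range_lc.
have phiN v : `|phi v| = `|th v| by rewrite -J1 phiE.
have thinj v : th v = 0 -> v = 0.
  move=> v0; have /andP[+ _] := thP v; rewrite v0 normr0 pmulr_rle0 ?expR_gt0//.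
  by rewrite normr_le0 => /eqP.
have phiinj : injective phi.
  move=> v w vw; apply/eqP; rewrite -subr_eq0; apply/eqP/thinj.
  by rewrite linearB -!phiE vw subrr.
have phisurj u : exists v, phi v = u.
  have [c cE] := JE u; exists (lc (fddim L) c (@std_basis R L)).
  apply/eqP; rewrite -subr_eq0 -normr_eq0 -J1 linearB phiE cE -lc_map subrr.
  by rewrite normr0.
have [S0 S0P] := choice phisurj.
have [S SE] : exists S : {linear E -> L}, forall v, S v = S0 v.
  apply: linear_mk => a v w; apply: phiinj.
  by rewrite linearP !S0P.
have phiS : cancel S phi by move=> v; rewrite SE S0P.
have Sphi : cancel phi S by move=> v; apply: phiinj; rewrite phiS.
have Sinj : injective S := can_inj phiS.
exists E; split; first by apply/AgeP; exists J.
apply: eB; split.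
  by apply/eqP; rewrite eqn_leq (fddim_le phiinj) (fddim_le Sinj).
apply: (@le_lt_trans _ _ (ln (opnorm phi * opnorm S))).
  apply: ge_inf; last by exists phi, S.
  by exists 0 => d; exact: BMdist_set_ge0.
have [p0|p0] := leP (opnorm phi * opnorm S) 0; first by rewrite ln0.
rewrite (@le_lt_trans _ _ (e / 3 + e / 3))//; last by lra.
rewrite -[leRHS]expRK ler_ln ?posrE ?expR_gt0// expRD.
apply: ler_pM; rewrite ?opnorm_ge0//; apply: opnorm_le; rewrite ?expR_ge0// => v.
  by rewrite phiN; have /andP[_] := thP v.
have /andP[+ _] := thP (S v).
by rewrite -phiN phiS expRN ler_pdivrMl ?expR_gt0.
Qed.

End age.

(** * The age of an omega-categorical space *)

Section age_class.
Context {R : realType} (X : normedModType R).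
Hypothesis cptX : forall n, compact [set: orbit_quotient (Iso_action X n)].
Implicit Types (E F G H L : fdspace R).

Lemma sim0_isometry E (V : normedModType R) (x : nat -> V) :
  sim (fddim E) 0 x (@std_basis R E) ->
  exists2 j : {linear E -> V}, forall v, `|j v| = `|v| &
    forall v, j v = lc (fddim E) (coord v) x.
Proof.
move=> xE; have [j jE] := tuple_linear E x; exists j => // v.
by rewrite jE (sim0P xE) -coord_std_basis.
Qed.

Lemma Age_of_Emb E : (forall d : R, 0 < d -> Emb d E X !=set0) -> Age X E.
Proof.
move=> Eemb.
have [h h0 hP] := sim0_of_sim cptX (fddim E) (@std_basis R E) ltr01.
have [d d0 dP] := sim_of_Emb (fddim E) (@std_basis R E) h0.
have [i iP] := Eemb d d0.
have [y yE _] := hP _ (dP _ i iP).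
by apply/AgeP; have [j j1 _] := sim0_isometry yE; exists j.
Qed.

Lemma Age_clE : Age_cl X = Age X.
Proof.
apply/seteqP; split=> [E /Age_cl_Emb|]; first exact: Age_of_Emb.
exact: subset_closure.
Qed.

Lemma Age_closed : closed (Age X).
Proof. by move=> E; rewrite -[X in X -> _]/(Age_cl X E) Age_clE. Qed.

Lemma Age_HP : HP (Age X).
Proof.
move=> E F /AgeP[j j1] [T /Emb0P T1]; apply/AgeP; exists (j \o T) => v.
by rewrite /= j1 T1.
Qed.

(** Joint embedding and amalgamation both take place in the span, inside X, of two
    subspaces. *)
Lemma Age_join G H (jG : {linear G -> X}) (jH : {linear H -> X}) :
  exists L (J : {linear L -> X}), [/\ forall v, `|J v| = `|v|,
    forall u, exists v, J v = jG u & forall u, exists v, J v = jH u].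
Proof.
pose x := cat_seq (fddim G) (jG \o @std_basis R G) (jH \o @std_basis R H).
have [L [J [J1 Jx _]]] := span_fdspace (fddim G + fddim H) x.
exists L, J; split=> // u; rewrite linear_coord.
  rewrite -(@eq_lc _ _ _ _ x) => [|i iG]; last by rewrite /x cat_seql.
  by apply: range_lc => i iG; apply: Jx; lia.
rewrite -(@eq_lc _ _ _ _ (fun i => x (fddim G + i)%N)) => [|i iG].
  by apply: range_lc => i iG; apply: Jx; rewrite ltn_add2l.
by rewrite /x cat_seqr.
Qed.

Lemma Age_JEP : JEP (Age X).
Proof.
move=> G H /AgeP[jG jG1] /AgeP[jH jH1].
have [L [J [J1 JG JH]]] := Age_join jG jH.
have [iG iGE] := linear_factor J1 JG; have [iH iHE] := linear_factor J1 JH.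
exists L; split; first by apply/AgeP; exists J.
- by exists iG; apply/Emb0P => v; rewrite -J1 iGE.
- by exists iH; apply/Emb0P => v; rewrite -J1 iHE.
Qed.

(** The tuple to which the guard is applied is the image of [f] followed by a basis
    of [G]; the isometric copy of the basis is the embedding of [G], and the linear
    relations between the two parts locate the image of [f]. *)
Lemma guarded_extension n m (e d : R) (y : nat -> X) F (J : {linear F -> X}) f :
  (n <= m)%N -> guarded n m e d y ->
  (forall v, `|J v| = `|v|) -> (forall i, (i < m)%N -> J (f i) = y i) ->
  forall G (psi : {linear F -> G}), Age X G -> sim m d (psi \o f) f ->
  exists2 i : {linear G -> X}, forall v, `|i v| = `|v| &
    forall k, (k < n)%N -> `|i (psi (f k)) - y k| < e.
Proof.
move=> nm yg J1 Jf G psi /AgeP[j j1] psid.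
pose g := fddim G; pose x := j \o @std_basis R G.
pose z := cat_seq m (j \o psi \o f) x.
have zy : sim m d z y.
  apply: (@sim_eql _ _ _ _ _ (j \o psi \o f)) => [i im|]; first by rewrite /z cat_seql.
  apply: (sim_trans0l (sim_iso m (psi \o f) j1)).
  apply: (sim_trans0r psid).
  apply: sim_sym; apply: sim_eql (sim_iso m f J1) => i im; exact: Jf.
have [z' z'z z'y] := yg y (m + g)%N z (sim_refl m y) (leq_addr _ _) zy.
have z'G : sim g 0 (fun i => z' (m + i)%N) (@std_basis R G).
  apply: (sim_trans0l (sim_shift (lexx 0) (leqnn _) z'z)).
  apply: sim_eql (sim_iso g (@std_basis R G) j1) => i _.
  by rewrite /z cat_seqr.
have [i i1 iE] := sim0_isometry z'G; exists i => // k kn.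
suff -> : i (psi (f k)) = z' k by exact: z'y.
rewrite iE; symmetry; apply: (sim_relation0 (f := addn m) _ _ z'z); first by lia.
  by move=> l; rewrite ltn_add2l.
rewrite /z cat_seql /=; last by lia.
by rewrite linear_coord; apply: eq_lc => l lg /=; rewrite cat_seqr.
Qed.

(** A guard of a basis of [E] gives the space [F]: its embeddings into spaces of
    the age extend to copies in X that almost agree on [E], and such copies can be
    joined inside X. *)
Lemma Age_GAP : GAP (Age X).
Proof.
move=> E e /AgeP[j j1] e0.
pose n := fddim E; pose x := j \o @std_basis R E.
have [K K0 KP] := l1norm_coord_le E.
have e'0 : 0 < e / (4 * K) by rewrite divr_gt0// mulr_gt0.
have [m [y [d0 [nm yx d00 yg]]]] := guarded_exists cptX n x e'0.
have [F [J [J1 Jy Jsp]]] := span_fdspace m y.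
have yE : sim n 0 y (@std_basis R E).
  exact: sim_trans0l yx (sim_iso n _ j1).
have [A A1 AE] := sim0_isometry yE.
have [phi phiE] : exists phi : {linear E -> F}, forall v, J (phi v) = A v.
  by apply: linear_factor => // u; rewrite AE; apply: range_lc => i ni; apply: Jy; lia.
have /choice[f fP] i : exists v, (i < m)%N -> J v = y i.
  have [im|mi] := ltnP i m; last by exists 0.
  by have [v vE] := Jy i im; exists v.
have [d dd0 dP] := sim_of_Emb m f d00.
exists F, phi, d; split => //.
- by apply/AgeP; exists J.
- by apply: (Emb_of_isometry (ltW e0)) => v; rewrite -J1 phiE A1.
move=> G H psiG psiH AG AH /dP psiGd /dP psiHd.
have [jG jG1 jGy] := guarded_extension nm yg J1 fP AG psiGd.
have [jH jH1 jHy] := guarded_extension nm yg J1 fP AH psiHd.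
have [L [JL [JL1 JG JH]]] := Age_join jG jH.
have [iG iGE] := linear_factor JL1 JG; have [iH iHE] := linear_factor JL1 JH.
exists L, iG, iH; split.
- by apply/AgeP; exists JL.
- by apply/Emb0P => v; rewrite -JL1 iGE.
- by apply/Emb0P => v; rewrite -JL1 iHE.
have phif k : (k < n)%N -> phi (std_basis E k) = f k.
  move=> kn; apply/eqP; rewrite -subr_eq0 -normr_eq0 -J1 linearB phiE.
  by rewrite (tuple_linear_basis AE kn) fP ?subrr ?normr0//; lia.
apply: (@le_lt_trans _ _ (e / 2)); last by rewrite ltr_pdivrMr// ltr_pMr// ltr1n.
apply: opnorm_le => [|v]; first by rewrite divr_ge0// ltW.
rewrite -JL1 linearB iGE iHE.
have -> := linear_coord (jG \o psiG \o phi) v : jG (psiG (phi v)) = _.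
have -> := linear_coord (jH \o psiH \o phi) v : jH (psiH (phi v)) = _.
apply: (le_trans (dist_lc_le _ (d := e / (4 * K) + e / (4 * K)) _)) => [k kn|].
  rewrite /= phif//; have := jGy k kn; have := jHy k kn.
  have := ler_distD (y k) (jG (psiG (f k))) (jH (psiH (f k))).
  rewrite [`|y k - _|]distrC; lra.
apply: (le_trans (ler_wpM2l _ (KP v))); first by rewrite addr_ge0// ltW.
by rewrite le_eqVlt; apply/orP; left; apply/eqP; field; rewrite gt_eqF.
Qed.

Lemma Age_neq0 : Age X !=set0.
Proof.
have [F [J [J1 _ _]]] := span_fdspace 0 (fun=> 0 : X).
by exists F; apply/AgeP; exists J.
Qed.

Lemma Age_guarded_Fraisse : guarded_Fraisse_class (Age X).
Proof.
split; [exact: Age_neq0|exact: Age_closed|exact: Age_HP|exact: Age_JEP|].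
exact: Age_GAP.
Qed.

End age_class.

(** * Back and forth *)

Section back_and_forth.
Context {R : realType}.

Lemma chain_choice (S : Type) (Inv : nat -> S -> Prop) (Rel : nat -> S -> S -> Prop)
    K s0 : Inv K s0 ->
  (forall k s, (K <= k)%N -> Inv k s -> exists2 s', Inv k.+1 s' & Rel k s s') ->
  exists2 f : nat -> S, f K = s0 &
    forall k, (K <= k)%N -> Inv k (f k) /\ Rel k (f k) (f k.+1).
Proof.
move=> I0 step.
have /choice[F FP] (ks : nat * S) : exists s', (K <= ks.1)%N -> Inv ks.1 ks.2 ->
    Inv ks.1.+1 s' /\ Rel ks.1 ks.2 s'.
  case: ks => k s /=; have [[Kk Is]|no] := pselect ((K <= k)%N /\ Inv k s).
    by have [s' ? ?] := step k s Kk Is; exists s'.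
  by exists s => Kk Is; case: no.
pose g := fix g j := if j is j'.+1 then F ((K + j')%N, g j') else s0.
have gI j : Inv (K + j)%N (g j).
  elim: j => [|j IH]; first by rewrite addn0.
  by rewrite addnS; apply: (FP (_, _) (leq_addr _ _) IH).1.
exists (fun k => g (k - K)%N) => [|k Kk]; first by rewrite subnn.
have := gI (k - K)%N; rewrite subnKC// => Ig; split => //.
rewrite subSn//=; have := FP ((K + (k - K))%N, g (k - K)%N) => /=.
by rewrite subnKC// => /(_ Kk Ig)[].
Qed.

(** Treating [dec k] at stage [k] treats every element at infinitely many stages;
    the parity matters in the back and forth, where the tuples are exchanged at each
    stage. *)
Lemma recurrent_decode (T : countType) (t0 : T) : exists dec : nat -> T,
  forall t K b, exists k, [/\ (K <= k)%N, odd k = b & dec k = t].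
Proof.
exists (fun k => odflt t0 (unpickle (logn 2 k./2.+1))) => t K b.
pose q := (2 ^ pickle t * K.*2.+1)%N.
have q0 : (0 < q)%N by rewrite muln_gt0 expn_gt0.
have Kq : (K < q)%N.
  apply: (@leq_trans K.*2.+1); first by lia.
  by rewrite leq_pmull// expn_gt0.
exists (q.-1.*2 + b)%N; split; first by lia.
  by rewrite oddD odd_double oddb.
rewrite addnC half_bit_double prednK// /q lognM ?expn_gt0// pfactorK//.
by rewrite [logn 2 K.*2.+1]logn_coprime ?addn0 ?pickleK// coprime2n /= odd_double.
Qed.

Lemma separable_enum (V : normedModType R) : separable V ->
  exists D : nat -> V, forall v (e : R), 0 < e -> exists n, `|v - D n| < e.
Proof.
move=> [A cA dA].
have /countable_injP[f fi] := cA.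
have /choice[D DP] n : exists a, forall b, A b -> f b = n -> a = b.
  have [[a Aa an]|nA] := pselect (exists2 a, A a & f a = n).
    exists a => b Ab bn; apply: fi; rewrite ?inE//; exact: etrans (esym bn).
  by exists 0 => b Ab bn; case: nA; exists b.
exists D => v e e0.
have [a [va Aa]] : ball v e `&` A !=set0.
  by apply: dA; [exists v; exact: ballxx|exact: ball_open].
by exists (f a); rewrite (DP _ a)//; move: va; rewrite -ball_normE.
Qed.

Section isometries_from_tuples.
Context {V : completeNormedModType R}.

Definition dense_span (x : nat -> V) :=
  forall v (e : R), 0 < e -> exists n c, `|v - lc n c x| < e.

Lemma lc_common n c n' c' : exists p (d d' : nat -> R),
  forall x : nat -> V, lc n c x = lc p d x /\ lc n' c' x = lc p d' x.
Proof.
exists (maxn n n'), (fun i => if (i < n)%N then c i else 0).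
exists (fun i => if (i < n')%N then c' i else 0) => x.
by split; apply: lc_widen; rewrite ?leq_maxl ?leq_maxr.
Qed.

Lemma dist_lc_sim0 (x y : nat -> V) n c n' c' : (forall n, sim n 0 x y) ->
  `|lc n c x - lc n' c' x| = `|lc n c y - lc n' c' y|.
Proof.
move=> xy; have [p [d [d' dE]]] := lc_common n c n' c'.
have [-> ->] := dE x; have [-> ->] := dE y.
by rewrite -!lcB (sim0P (xy p)).
Qed.

(** The closure of the graph of the correspondence of combinations of [x] and of
    [y]. For isometric sequences it is the graph of a linear isometry, and its
    definition is symmetric in the two sequences. *)
Definition span_graph (x y : nat -> V) (v w : V) :=
  forall e : R, 0 < e -> exists n c, `|v - lc n c x| < e /\ `|w - lc n c y| < e.

Lemma span_graph_total (x y : nat -> V) v : (forall n, sim n 0 x y) ->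
  dense_span x -> exists w, span_graph x y v w.
Proof.
move=> xy dx.
have /choice[nc ncP] k : exists nc : nat * (nat -> R),
    `|v - lc nc.1 nc.2 x| < pow2 k.+1.
  by have [n [c vc]] := dx v _ (pow2_gt0 k.+1); exists (n, c).
have [k _|w wP] := @pow2_cauchy_cvg R V (fun k => lc (nc k).1 (nc k).2 y) 0.
  rewrite -(dist_lc_sim0 _ _ _ _ xy) (le_trans (ler_distD v _ _))//.
  rewrite [`|_ - v|]distrC (pow2S k) lerD// ltW//.
  by apply: lt_trans (ncP k.+1) _; rewrite (pow2S k.+1) ltrDl pow2_gt0.
exists w => e e0; have [N NP] := pow2_small (divr_gt0 e0 (ltr0n R 2)).
exists (nc N).1, (nc N).2; split.
  apply: lt_trans (ncP N) _; have := NP N (leqnn _); rewrite (pow2S N).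
  by have := pow2_gt0 N.+1; lra.
by apply: le_lt_trans (wP N _) _ => //; have := NP N (leqnn _); lra.
Qed.

Lemma span_graph_norm (x y : nat -> V) v w : (forall n, sim n 0 x y) ->
  span_graph x y v w -> `|w| = `|v|.
Proof.
move=> xy vw; apply/eqP; rewrite -subr_eq0 -normr_le0; apply/ler_addgt0Pl => e e0.
have [n [c [vc wc]]] := vw _ (divr_gt0 e0 (ltr0n R 2)).
have := sim0P (xy n) c; have := ler_dist_dist v (lc n c x).
have := ler_dist_dist w (lc n c y); rewrite addr0 => h1 h2 h3.
rewrite (le_trans (ler_distD `|lc n c y| _ _))// -{2}h3 (distrC _ `|v|).
by lra.
Qed.

Lemma span_graph_linear (x y : nat -> V) (a : R) v w v' w' :
  span_graph x y v w -> span_graph x y v' w' ->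
  span_graph x y (a *: v + v') (a *: w + w').
Proof.
move=> vw vw' e e0.
have a1 : 0 < `|a| + 1 by rewrite ltr_wpDl.
have e1 : 0 < e / (2 * (`|a| + 1)) by rewrite divr_gt0// mulr_gt0.
have [n [c [vc wc]]] := vw _ e1.
have [n' [c' [vc' wc']]] := vw' _ e1.
have [p [d [d' dE]]] := lc_common n c n' c'.
exists p, (fun i => a * d i + d' i).
have bound (z z' u u' : V) : `|z - u| < e / (2 * (`|a| + 1)) ->
    `|z' - u'| < e / (2 * (`|a| + 1)) -> `|a *: z + z' - (a *: u + u')| < e.
  move=> zu zu'; rewrite opprD addrACA -scalerBr.
  rewrite (le_lt_trans (ler_normD _ _))// normrZ.
  have eE : e = (`|a| + 1) * (e / (2 * (`|a| + 1))) * 2.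
    by field; rewrite gt_eqF.
  rewrite [ltRHS]eE; move: (e / _) zu zu' e1 => h zu zu' h0.
  have := ler_wpM2l (normr_ge0 a) (ltW zu); have := mulr_ge0 (normr_ge0 a) (ltW h0).
  by lra.
by rewrite !lc_linear -!(dE x).1 -!(dE x).2 -!(dE y).1 -!(dE y).2; split; apply: bound.
Qed.

Lemma isometry_of_tuples (x y : nat -> V) : (forall n, sim n 0 x y) ->
  dense_span x -> dense_span y ->
  exists2 T, Iso V T & forall v w, span_graph x y v w -> T v = w.
Proof.
move=> xy dx dy.
have yx n : sim n 0 y x by exact: sim_sym.
have /choice[f fP] v : exists w, span_graph x y v w by exact: span_graph_total.
have uniq v w w' : span_graph x y v w -> span_graph x y v w' -> w = w'.
  move=> vw vw'; apply/eqP; rewrite -subr_eq0 -normr_eq0.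
  have := span_graph_norm xy (span_graph_linear (-1) vw vw').
  by rewrite !scaleN1r addNr normr0 addrC -opprB normrN => ->.
have [T TE] : exists T : {linear V -> V}, forall v, T v = f v.
  by apply: linear_mk => a v w; apply: uniq (fP _) (span_graph_linear a (fP v) (fP w)).
exists T; last by move=> v w; apply: uniq; rewrite TE.
split=> [v|]; first by rewrite TE; exact: span_graph_norm (fP v).
apply/seteqP; split=> // w _; have [v vw] := span_graph_total w yx dy.
exists v => //; rewrite TE; apply: uniq (fP v) _ => e /vw[n [c [? ?]]].
by exists n, c.
Qed.

Lemma span_graph_nth (x y : nat -> V) i : span_graph x y (x i) (y i).
Proof.
move=> e e0; exists i.+1, (fun j => (i == j)%:R).
by rewrite !lc1// !subrr normr0.
Qed.

End isometries_from_tuples.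

End back_and_forth.

Section extension_property.
Context {R : realType} (Z : completeNormedModType R).

(** The guard condition inside Z, where copies are only found up to arbitrary
    precision. *)
Definition guards_in s m (d e : R) (x : nat -> Z) :=
  forall p (g : nat -> Z) (h : R), (m <= p)%N -> sim m d g x -> 0 < h ->
  exists2 g' : nat -> Z, sim p h g' g & forall i, (i < s)%N -> `|g' i - x i| < e.

Definition extension_property :=
  forall s (x : nat -> Z) (e : R), 0 < e -> exists m (x' : nat -> Z) (d : R),
    [/\ (s <= m)%N, 0 < d, forall i, (i < s)%N -> x' i = x i & guards_in s m d e x'].

Hypothesis sepZ : separable Z.
Hypothesis extZ : extension_property.

(** A stage of the back and forth: [bf_x] is guarded, and [bf_y] is almost
    isometric to it. The two tuples are exchanged from each stage to the next. *)
Record bf_stage := BfStage {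
  bf_s : nat ; bf_m : nat ; bf_d : R ; bf_x : nat -> Z ; bf_y : nat -> Z }.

Definition bf_inv k (t : bf_stage) :=
  [/\ (bf_s t <= bf_m t)%N, 0 < bf_d t,
    guards_in (bf_s t) (bf_m t) (bf_d t) (pow2 k) (bf_x t) &
    sim (bf_m t) (bf_d t) (bf_y t) (bf_x t)].

Definition bf_rel (D : nat -> Z) k (t t' : bf_stage) :=
  [/\ bf_s t' = (bf_m t).+1,
    forall i, (i < bf_m t)%N -> bf_x t' i = bf_y t i,
    forall i, (i < bf_s t)%N -> `|bf_y t' i - bf_x t i| < pow2 k,
    bf_x t' (bf_m t) = D k &
    sim (bf_m t') (pow2 k) (bf_y t') (bf_x t')].

(** Append the vector [D k] to [bf_y], guard the result, and use the guard of
    [bf_x] to copy the result back next to [bf_x]. *)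
Lemma bf_step D k t : bf_inv k t -> exists2 t', bf_inv k.+1 t' & bf_rel D k t t'.
Proof.
case: t => s m d x y; rewrite /bf_inv /bf_rel /= => -[sm d0 gx yx].
pose y1 := cat_seq m y (fun=> D k).
have [m' [y' [d' [mm' d'0 y'E gy']]]] := extZ m.+1 y1 (pow2_gt0 k.+1).
have yE i : (i < m)%N -> y' i = y i.
  by move=> im; rewrite y'E ?ltnS ?(ltnW im)// /y1 cat_seql.
have h0 : 0 < Num.min d' (pow2 k) by rewrite lt_min d'0 pow2_gt0.
have y'x : sim m d y' x by apply: sim_eql yx => i im; rewrite yE.
have [x' x'y' x'x] := gx m' y' _ (ltnW mm') y'x h0.
exists (BfStage m.+1 m' d' y' x') => /=; split => //.
- by apply: sim_le x'y'; rewrite ge_min lexx.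
- by rewrite y'E ?ltnSn// /y1 -[X in cat_seq _ _ _ X]addn0 cat_seqr.
- by apply: sim_le x'y'; rewrite ge_min lexx orbT.
Qed.

(** Undo the exchanges: [bf_fst t k] converges as [k] grows, and so does
    [bf_snd t k]. *)
Definition bf_fst (t : nat -> bf_stage) k := if odd k then bf_y (t k) else bf_x (t k).
Definition bf_snd (t : nat -> bf_stage) k := if odd k then bf_x (t k) else bf_y (t k).

(** Every entry belongs to the guarded part from some stage on, and moves by a
    summable amount afterwards. The vectors [D k] enter both tuples infinitely
    often, which makes the spans dense, and the errors of [sim] tend to 0. *)
Lemma bf_limit (t : nat -> bf_stage) D K :
  (forall v (e : R) k b, 0 < e -> exists j, [/\ (k <= j)%N, odd j = b & `|v - D j| < e]) ->
  (forall k, (K <= k)%N -> bf_inv k (t k) /\ bf_rel D k (t k) (t k.+1)) ->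
  exists x y : nat -> Z, [/\ forall n, sim n 0 x y, dense_span x, dense_span y,
    forall i, (i < bf_s (t K))%N -> `|x i - bf_fst t K i| <= pow2 K + pow2 K &
    forall i, (i < bf_s (t K))%N -> `|y i - bf_snd t K i| <= pow2 K + pow2 K].
Proof.
move=> Ddense tP.
have sS k : (K <= k)%N -> (bf_s (t k) < bf_s (t k.+1))%N.
  by move=> /tP[[sm _ _ _] [-> _ _ _ _]]; rewrite ltnS.
have s_mono k j : (K <= k)%N -> (bf_s (t k) <= bf_s (t (k + j)%N))%N.
  move=> Kk; elim: j => [|j IH]; first by rewrite addn0.
  by rewrite addnS (leq_trans IH)// ltnW// sS// (leq_trans Kk)// leq_addr.
have s_ge j : (j <= bf_s (t (K + j)%N))%N.
  elim: j => [|j IH]; first by [].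
  by rewrite addnS (leq_ltn_trans IH)// sS// leq_addr.
have fstS k i : (K <= k)%N -> (i < bf_s (t k))%N ->
    `|bf_fst t k.+1 i - bf_fst t k i| <= pow2 k.
  move=> /tP[[sm _ _ _] [_ xE yE _ _]] ik; rewrite /bf_fst /=.
  case: (odd k) => /=; last exact/ltW/yE.
  by rewrite xE ?subrr ?normr0 ?ltW ?pow2_gt0//; exact: leq_trans sm.
have sndS k i : (K <= k)%N -> (i < bf_s (t k))%N ->
    `|bf_snd t k.+1 i - bf_snd t k i| <= pow2 k.
  move=> /tP[[sm _ _ _] [_ xE yE _ _]] ik; rewrite /bf_snd /=.
  case: (odd k) => /=; first exact/ltW/yE.
  by rewrite xE ?subrr ?normr0 ?ltW ?pow2_gt0//; exact: leq_trans sm.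
have lim (u : nat -> nat -> Z) :
    (forall k i, (K <= k)%N -> (i < bf_s (t k))%N -> `|u k.+1 i - u k i| <= pow2 k) ->
    exists x : nat -> Z, forall k i, (K <= k)%N -> (i < bf_s (t k))%N ->
      `|x i - u k i| <= pow2 k + pow2 k.
  move=> uS; suff /choice[x xP] i : exists l, forall k, (K <= k)%N ->
      (i < bf_s (t k))%N -> `|l - u k i| <= pow2 k + pow2 k.
    by exists x => k i; exact: xP.
  have [[k0 [Kk0 ik0] k0min]|none] := pselect (exists2 k0, (K <= k0)%N /\
      (i < bf_s (t k0))%N & forall k, (K <= k)%N -> (i < bf_s (t k))%N -> (k0 <= k)%N).
    have [k k0k|l lP] := @pow2_cauchy_cvg R Z (fun k => u k i) k0.
      apply: uS; first exact: leq_trans k0k.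
      by apply: leq_trans ik0 _; rewrite -(subnKC k0k); exact: s_mono.
    by exists l => k Kk ik; apply: lP; exact: k0min.
  exists 0 => k Kk ik; case: none.
  have exk : exists k, (K <= k)%N && (i < bf_s (t k))%N by exists k; rewrite Kk.
  case: (ex_minnP exk) => k0 /andP[Kk0 ik0] k0min; exists k0 => [//|j Kj ij].
  by apply: k0min; rewrite Kj.
have [x xP] := lim _ fstS; have [y yP] := lim _ sndS.
have big n (e : R) : 0 < e -> exists k, [/\ (K < k)%N, (n <= bf_s (t k))%N & pow2 k < e / 8].
  move=> e0; have [N NP] := pow2_small (divr_gt0 e0 (ltr0n R 8)).
  exists (K + (n + N).+1)%N; split; [by lia| |by apply: NP; lia].
  by apply: leq_trans (s_ge _); lia.
have xy n : sim n 0 x y.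
  move=> c; rewrite mul0r; apply/ler_addgt0Pl => e e0; rewrite addr0.
  have L0 : 0 < l1norm n c + 1 by rewrite ltr_wpDl// l1norm_ge0.
  have [k1 [Kk1 nk ke]] := big n _ (divr_gt0 e0 L0).
  case: k1 Kk1 nk ke => [//|k] Kk nk ke.
  have Kk' : (K <= k.+1)%N by exact: ltnW.
  have [[sm _ _ _] _] := tP _ Kk'.
  have [_ [_ _ _ _ tsim]] := tP k Kk.
  have st : sim n (pow2 k) (bf_fst t k.+1) (bf_snd t k.+1).
    rewrite /bf_fst /bf_snd; have pk := ltW (pow2_gt0 (R := R) k).
    have ts := sim_widen pk (leq_trans nk sm) tsim.
    by case: ifP => // _; exact: sim_sym.
  have sx : sim n (pow2 k.+1 + pow2 k.+1) x (bf_fst t k.+1).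
    by apply: sim_near => i ni; apply: xP => //; exact: leq_trans nk.
  have sy : sim n (pow2 k.+1 + pow2 k.+1) (bf_snd t k.+1) y.
    apply: sim_near => i ni; rewrite distrC; apply: yP => //.
    exact: leq_trans nk.
  have := sim_trans (sim_trans sx st) sy c => /le_trans; apply.
  rewrite -[leRHS](divfK (lt0r_neq0 L0)); rewrite (pow2S k).
  have L1 := l1norm_ge0 n c; have p0 := pow2_gt0 (R := R) k.+1.
  move: (e / _) ke => q ke.
  rewrite (@le_trans _ _ (q * l1norm n c))//; last by rewrite ler_wpM2l//; lra.
  by rewrite ler_wpM2r//; lra.
have dense b : dense_span (if b then x else y).
  move=> v e e0; have [N NP] := pow2_small (divr_gt0 e0 (ltr0n R 4)).
  have [k [Kk kb vk]] := Ddense v (e / 4) (K + N)%N b (divr_gt0 e0 (ltr0n R 4)).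
  have Kk1 : (K <= k)%N by lia.
  have [_ [sE _ _ DE _]] := tP k Kk1.
  have ms : (bf_m (t k) < bf_s (t k.+1))%N by rewrite sE.
  exists (bf_m (t k)).+1, (fun j => (bf_m (t k) == j)%:R); rewrite lc1//.
  have h1 := xP k.+1 _ (leqW Kk1) ms; have h2 := yP k.+1 _ (leqW Kk1) ms.
  (* [D k] was put into [bf_x] at stage [k.+1], hence into [bf_fst] if [k] is odd *)
  rewrite /bf_fst /bf_snd /= kb in h1 h2.
  have pk : pow2 k < e / 4 by apply: NP; lia.
  rewrite (pow2S k) in pk.
  have {}h1 : `|D k - (if b then x else y) (bf_m (t k))| <= pow2 k.+1 + pow2 k.+1.
    by rewrite distrC; case: (b) h1 h2 => /=; rewrite ?DE.
  rewrite (le_lt_trans (ler_distD (D k) _ _))//; lra.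
exists x, y; split => //; first exact: dense true.
- exact: dense false.
- by move=> i ik; exact: xP.
- by move=> i ik; exact: yP.
Qed.

(** The stages start at [K], so that the total displacement of an entry of the
    guarded part is of the order of [pow2 K]; for even [K] the tuples are not
    exchanged at the start. *)
Lemma extension_homogeneous s m d x (y : nat -> Z) K : ~~ odd K -> (s <= m)%N ->
  0 < d -> guards_in s m d (pow2 K) x -> sim m d y x ->
  exists2 T, Iso Z T & forall i, (i < s)%N -> `|T (x i) - y i| <= pow2 K *+ 4.
Proof.
move=> oK sm d0 gx yx.
have [D0 D0P] := separable_enum sepZ.
have [dec decP] := recurrent_decode 0%N.
pose D := D0 \o dec.
have DP v (e : R) k b : 0 < e -> exists j, [/\ (k <= j)%N, odd j = b & `|v - D j| < e].
  move=> e0; have [n nP] := D0P v e e0; have [j [kj jb jn]] := decP n k b.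
  by exists j; split => //; rewrite /D /= jn.
pose t0 := BfStage s m d x y.
have [t tK tP] : exists2 t : nat -> bf_stage, t K = t0 & forall k, (K <= k)%N ->
    bf_inv k (t k) /\ bf_rel D k (t k) (t k.+1).
  by apply: chain_choice => // k t1 _; exact: bf_step.
have [x' [y' [xy dx dy]]] := bf_limit DP tP.
rewrite /bf_fst /bf_snd (negbTE oK) tK /= => xx' yy'.
have [T TI TE] := isometry_of_tuples xy dx dy.
exists T => // i si; have Ti := TE _ _ (span_graph_nth x' y' i).
rewrite (le_trans (ler_distD (y' i) _ _))//.
rewrite -{1}Ti -linearB TI.1 [`|x i - _|]distrC.
apply: le_trans (lerD (xx' i si) (yy' i si)) _.
by rewrite -mulr2n -mulr2n -mulrnA.
Qed.

(** Both embeddings are compared with the inclusion. *)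
Lemma extension_guarded_Fraisse : guarded_Fraisse_space Z.
Proof.
split=> // E e e0.
have [B [T0 [T01 T0s]]] := fdsub_fdspace E.
have [J JE] := fdsub_val_map E.
pose s := fddim B; pose b := J \o T0 \o @std_basis R B.
have [C C0 CP] := l1norm_coord_le B.
have e80 : 0 < e / (8 * C) by rewrite divr_gt0// mulr_gt0.
have [K0 K0P] := pow2_small e80.
pose K := K0.*2; have KC : pow2 K < e / (8 * C) by apply: K0P; rewrite /K; lia.
have oK : ~~ odd K by rewrite odd_double.
have [m [x [d [sm d0 xb gx]]]] := extZ s b (pow2_gt0 K).
have finF : exists n (v : 'I_n -> Z), range (fun c => lc m c x) = Defs.span v.
  by exists m, (fun i : 'I_m => x i); rewrite span_lc.
pose F := FdSubspace finF.
have [JF JFE] := fdsub_val_map F.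
have valT0 w : fdsub_val (T0 w) = lc s (coord w) x.
  rewrite -JE -[J (T0 w)]/((J \o T0) w) linear_coord.
  by apply: eq_lc => i si; rewrite xb.
have EF : fdsub_set E `<=` fdsub_set F.
  move=> v /fdsub_mem[w <-]; have [u _ <-] : range T0 w by rewrite T0s.
  by rewrite valT0 (lc_widen _ _ sm); eexists.
have /choice[f fP] i : exists v : F, (i < m)%N -> fdsub_val v = x i.
  have [im|_] := ltnP i m; last by exists 0.
  have [|v vE] := @fdsub_mem R Z F (x i); last by exists v.
  by exists (fun j => (i == j)%:R) => //; exact: lc1.
have [h h0 hP] := sim_of_Emb m f d0.
exists h, F, EF; split => // i i' /hP ix /hP i'x.
have fx : sim m 0 f x.
  apply: sim_sym; apply: (sim_eql (x := JF \o f)) => [k km|].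
    by rewrite /= JFE fP.
  by apply: sim_iso => v; rewrite JFE.
have [T TI Ti] := extension_homogeneous oK sm d0 gx (sim_trans0r ix fx).
have [T' TI' Ti'] := extension_homogeneous oK sm d0 gx (sim_trans0r i'x fx).
have [S [SI TS ST]] := Iso_inv TI.
exists (T' \o S); first exact: Iso_comp.
apply: (@le_lt_trans _ _ (pow2 K *+ 8 * C)); last first.
  rewrite -mulr_natl -[ltRHS](divfK (lt0r_neq0 C0)) ltr_pM2r//.
  rewrite -ltr_pdivlMl//; apply: lt_le_trans KC _.
  by rewrite le_eqVlt; apply/orP; left; apply/eqP; field; rewrite gt_eqF.
have p8 : 0 <= pow2 K *+ 8 :> R by rewrite mulrn_wge0// ltW// pow2_gt0.
apply: opnorm_le => [|v]; first by rewrite mulr_ge0// ltW.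
have [w _ wv] : range T0 v by rewrite T0s.
have inclE : fdsub_incl EF v = lc s (coord w) f.
  apply: val_inj; rewrite /= -wv valT0 -JFE -lc_map.
  by apply: eq_lc => k ks; rewrite /= JFE fP//; exact: leq_trans sm.
rewrite inclE /=.
have -> : T' (S (i (lc s (coord w) f))) = lc s (coord w) (T' \o (S \o (i \o f))).
  by rewrite !lc_map.
rewrite -(lc_map i').
apply: le_trans (dist_lc_le (coord w) (d := pow2 K *+ 8) _) _; last first.
  by rewrite -mulrA -wv T01 (ler_wpM2l p8).
move=> k ks /=; rewrite (le_trans (ler_distD (T' (x k)) _ _))//.
rewrite (_ : pow2 K *+ 8 = pow2 K *+ 4 + pow2 K *+ 4); last by rewrite -mulrnDr.
rewrite lerD//; first by rewrite distrC Ti'.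
by rewrite -linearB TI'.1 -(TI.1 (x k - _)) linearB ST Ti.
Qed.

End extension_property.

(** * A generic sequence *)

Section generic_sequence.
Context {R : realType} (X : completeNormedModType R).
Hypothesis cptX : forall n, compact [set: orbit_quotient (Iso_action X n)].
Variable D : nat -> X.
Hypothesis denseD : forall v (e : R), 0 < e -> exists n, `|v - D n| < e.

(** A request [(n, m, a, b, p, t, s)] asks for a copy of a [p]-tuple that is
    [pow2 t]-close to the entries of [D] listed in [s] and that, up to [pow2 a],
    extends the first [m] entries of the sequence; the copy has to agree with the
    sequence on [n] entries up to [pow2 b]. There are countably many requests. *)
Record request := Request {
  rq_n : nat ; rq_m : nat ; rq_a : nat ; rq_b : nat ; rq_p : nat ; rq_t : nat ;
  rq_s : seq nat }.

Definition request_code r :=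
  (rq_n r, rq_m r, rq_a r, rq_b r, rq_p r, rq_t r, rq_s r).

Definition request_of (c : nat * nat * nat * nat * nat * nat * seq nat) :=
  let '(n, m, a, b, p, t, s) := c in Request n m a b p t s.

Lemma request_codeK : cancel request_code request_of.
Proof. by case. Qed.

Definition near_request r (g : nat -> X) :=
  forall i, (i < rq_p r)%N -> `|g i - D (nth 0%N (rq_s r) i)| < pow2 (rq_t r).

Definition active r (z : nat -> X) :=
  [/\ (rq_n r <= rq_m r)%N, (rq_m r <= rq_p r)%N,
    guarded (rq_n r) (rq_m r) (pow2 (rq_b r)) (pow2 (rq_a r)) z &
    exists2 g, near_request r g & sim (rq_m r) (pow2 (rq_a r)) g z].

Definition answered r (z : nat -> X) q :=
  (exists2 g, near_request r g & sim (rq_p r) 0 (fun i => z (q + i)%N) g) /\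
  forall i, (i < rq_n r)%N -> `|z (q + i)%N - z i| < pow2 (rq_b r).

Record gs_stage := GsStage { gs_n : nat ; gs_m : nat ; gs_d : R ; gs_z : nat -> X }.

Definition gs_inv k t :=
  [/\ (gs_n t <= gs_m t)%N, 0 < gs_d t & guarded (gs_n t) (gs_m t) (pow2 k) (gs_d t) (gs_z t)].

Definition gs_rel (dec : nat -> request) k t t' :=
  [/\ (gs_m t < gs_n t')%N, sim (gs_m t) 0 (gs_z t') (gs_z t),
    forall i, (i < gs_n t)%N -> `|gs_z t' i - gs_z t i| < pow2 k &
    (rq_m (dec k) <= gs_m t)%N -> active (dec k) (gs_z t) ->
    exists2 q, (q + rq_p (dec k) <= gs_n t')%N & answered (dec k) (gs_z t') q].

Lemma answered_sim r (z w : nat -> X) q N : (rq_n r <= rq_p r)%N ->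
  (q + rq_p r <= N)%N ->
  sim N 0 w z -> answered r z q -> answered r w q.
Proof.
move=> np qN wz [[g rg zg] zn]; split.
  by exists g => //; apply: sim_trans0l zg; exact: sim_shift wz.
move=> i ni; apply: le_lt_trans (zn i ni).
have := @sim_dist R N 0 X X w z (q + i)%N i (lexx 0) _ _ wz.
by rewrite mul0r addr0; apply; lia.
Qed.

(** The answer to the request is appended to the sequence, a guard of the result
    is added, and the whole is moved next to the previous sequence, which is
    possible because that one was guarded. *)
Lemma gs_step dec k t : gs_inv k t -> exists2 t', gs_inv k.+1 t' & gs_rel dec k t t'.
Proof.
case: t => n m d z; rewrite /gs_inv /gs_rel /= => -[nm d0 gz].
set r := dec k.
have [g' g'P] : exists g' : nat -> X, active r z -> (exists2 g, near_request r g &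
    sim (rq_p r) 0 g' g) /\ forall i, (i < rq_n r)%N -> `|g' i - z i| < pow2 (rq_b r).
  have [[rnm rmp rg [g rgn gz1]]|no] := pselect (active r z); last by exists z.
  have [g' g'g g'z] := rg z _ g (sim_refl _ z) rmp gz1.
  by exists g' => _; split => //; exists g.
pose u := cat_seq m z g'.
have uz : sim m 0 u z by apply: sim_eq => i im; rewrite /u cat_seql.
have [m' [y [d' [Nm' yu d'0 gy]]]] :=
  guarded_exists cptX (m + rq_p r).+1 u (pow2_gt0 (R := R) k.+1).
have mN : (m <= (m + rq_p r).+1)%N by lia.
have yz : sim m 0 y z := sim_trans0l (sim_widen (lexx 0) mN yu) uz.
have [z' z'y z'z] := gz z m' y (sim_refl m z) (leq_trans mN Nm') (sim_le (ltW d0) yz).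
exists (GsStage (m + rq_p r).+1 m' d' z') => /=; split => //.
- exact: guarded_sim z'y gy.
- by rewrite ltnS leq_addr.
- exact: sim_trans0l (sim_widen (lexx 0) (leq_trans mN Nm') z'y) yz.
move=> rm ract; have [[g rgn g'g] g'z] := g'P ract.
have [rnm rmp _ _] := ract.
exists m; first exact: leqnSn.
apply: (@answered_sim r u _ m (m + rq_p r).+1) => //; first exact: leq_trans rmp.
  exact: sim_trans0l (sim_widen (lexx 0) Nm' z'y) yu.
split.
  by exists g => //; apply: sim_eql g'g => i _; rewrite /u cat_seqr.
by move=> i ni; rewrite /u cat_seqr cat_seql ?g'z//; lia.
Qed.

(** The norms of combinations of the first [gs_m] entries do not change after their
    stage, so the limit of the stages is isometric to each of them; guards and
    answers depend on these norms only. A tuple [g] that is not on the countable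
    list of requests is served through a listed tuple close to it. *)
Lemma generic_sequence : exists z : nat -> X,
  (forall n (e : R), 0 < e -> exists n' m d,
    [/\ (n <= n')%N, (n' <= m)%N, 0 < d & guarded n' m e d z]) /\
  forall n m a b p (g : nat -> X) (h : R), (n <= m)%N -> (m <= p)%N ->
    guarded n m (pow2 b) (pow2 a) z -> sim m (pow2 a) g z -> 0 < h ->
    exists2 q, sim p h (fun i => z (q + i)%N) g &
      forall i, (i < n)%N -> `|z (q + i)%N - z i| < pow2 b.
Proof.
have [dec0 dec0P] := recurrent_decode (request_code (Request 0 0 0 0 0 0 [::])).
pose dec := request_of \o dec0.
have decP r K : exists2 k, (K <= k)%N & dec k = r.
  have [k [Kk _ kr]] := dec0P (request_code r) K false.
  by exists k => //; rewrite /dec /= kr request_codeK.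
have [m0 [y0 [d0 [_ _ d00 gy0]]]] := guarded_exists cptX 0 (fun=> 0) (pow2_gt0 (R := R) 0).
have [||t t0 tP0] := @chain_choice _ gs_inv (gs_rel dec) 0 (GsStage 0 m0 d0 y0).
- by split.
- by move=> k t _; exact: gs_step.
have tP k : gs_inv k (t k) /\ gs_rel dec k (t k) (t k.+1) by exact: tP0.
pose n k := gs_n (t k); pose m k := gs_m (t k); pose u k := gs_z (t k).
have nm k : (n k <= m k)%N by have [[]] := tP k.
have mn k : (m k < n k.+1)%N by have [_ []] := tP k.
have m_mono k j : (m k <= m (k + j)%N)%N.
  elim: j => [|j IH]; first by rewrite addn0.
  by rewrite addnS (leq_trans IH)// (leq_trans (ltnW (mn _)))//.
have n_mono k j : (n k <= n (k + j)%N)%N.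
  elim: j => [|j IH]; first by rewrite addn0.
  by rewrite addnS (leq_trans IH)// (leq_trans (nm _))// ltnW.
have n_ge k : (k <= n k)%N.
  elim: k => [//|k IH].
  by rewrite (leq_ltn_trans IH)// (leq_ltn_trans (nm _)).
have usim k j : sim (m k) 0 (u (k + j)%N) (u k).
  elim: j => [|j IH]; first by rewrite addn0; exact: sim_refl.
  rewrite addnS; have [_ [_ tsim _ _]] := tP (k + j)%N.
  exact: sim_trans0l (sim_widen (lexx 0) (m_mono k j) tsim) IH.
have /choice[z zP] i : exists l, forall k, (i < k)%N -> `|l - u k i| <= pow2 k + pow2 k.
  have [k ik|l lP] := @pow2_cauchy_cvg R X (fun k => u k i) i.+1; last by exists l.
  have [_ [_ _ tz _]] := tP k; apply/ltW/tz.
  exact: leq_trans (n_ge k).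
have zu k : sim (m k) 0 z (u k).
  move=> c; rewrite mul0r; apply/ler_addgt0Pl => e e0; rewrite addr0.
  have L0 : 0 < l1norm (m k) c + 1 by rewrite ltr_wpDl// l1norm_ge0.
  have [N NP] := pow2_small (divr_gt0 e0 (mulr_gt0 (ltr0n R 2) L0)).
  pose j := (N + m k)%N.
  have zuj : sim (m k) (pow2 (k + j) + pow2 (k + j)) z (u (k + j)%N).
    by apply: sim_near => i im; apply: zP; rewrite /j; lia.
  have := sim_trans0r zuj (usim k j) c => /le_trans; apply.
  have := NP (k + j)%N; rewrite /j => /(_ _)/ltW kjN.
  apply: (@le_trans _ _ ((e / (2 * (l1norm (m k) c + 1)) +
    e / (2 * (l1norm (m k) c + 1))) * l1norm (m k) c)).
    by rewrite ler_wpM2r ?l1norm_ge0// lerD// kjN//; lia.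
  rewrite -[leRHS](divfK (lt0r_neq0 (mulr_gt0 (ltr0n R 2) L0))).
  have := divr_gt0 e0 (mulr_gt0 (ltr0n R 2) L0); move: (e / _) => q q0.
  lra.
exists z; split.
  move=> l e e0; have [N NP] := pow2_small e0.
  have [[_ dk gk] _] := tP (N + l)%N.
  exists (n (N + l)%N), (m (N + l)%N), (gs_d (t (N + l)%N)); split => //.
    by apply: leq_trans (n_ge _); lia.
  apply: guarded_sim (zu (N + l)%N) _; apply: guarded_le gk => //.
  by apply/ltW/NP; lia.
move=> n1 m1 a b p g h nm1 mp1 gz gsim h0.
have [T TP] := pow2_small (divr_gt0 h0 (ltr0n R 2)).
have /choice[f fP] i : exists l, `|g i - D l| < pow2 T by exact/denseD/pow2_gt0.
pose r := Request n1 m1 a b p T (mkseq f p).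
have [k mk kr] := decP r m1.
have mmk : (m1 <= m k)%N by rewrite (leq_trans mk)// (leq_trans (n_ge k)).
have [_ [_ _ _ ans]] := tP k; rewrite kr in ans.
have uz1 : sim m1 0 (u k) z by apply: sim_sym; exact: sim_widen (zu k).
have near : near_request r g.
  by move=> i ip; rewrite /= nth_mkseq.
have [//||q qn [[g1 g1P ug1] un]] := ans.
  split => //; first exact: guarded_sim gz.
  by exists g => //; apply: sim_trans0r gsim _; exact: sim_sym.
have pm : (q + p <= m k.+1)%N by exact: leq_trans (nm _).
have zuk : sim (q + p) 0 z (u k.+1) by exact: sim_widen (zu k.+1).
have [[g2 g2P zg2] zn] : answered r z q.
  apply: (answered_sim (N := (q + p)%N) (z := u k.+1)) => //=; first by lia.
  by split => //; exists g1.
exists q => //; apply: sim_trans0l zg2 _; apply: sim_near => i ip.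
have := g2P i ip; have := near i ip; rewrite /= nth_mkseq// => h1 h2.
rewrite (le_trans (ler_distD (D (f i)) _ _))// [`|_ - g i|]distrC.
have := TP T (leqnn _); lra.
Qed.

End generic_sequence.

(** * The limit space *)

Record closed_subspace (R : realType) (V : normedModType R) := ClosedSubspace {
  csub_set : set V ;
  csub_submod : submod_closed [pred v | `[< csub_set v >]] ;
  csub_closed : closed csub_set
}.

Section closed_subspace_complete.
Context {R : realType} {V : completeNormedModType R} (S : closed_subspace V).

Definition csub_pred : {pred V} := [pred v | `[< csub_set S v >]].

HB.instance Definition _ :=
  GRing.isSubmodClosed.Build R V csub_pred (csub_submod S).

Record csub_sort := CSub { csub_val : V ; csub_valP : csub_val \in csub_pred }.

HB.instance Definition _ := [isSub for csub_val].
HB.instance Definition _ := [Choice of csub_sort by <:].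
HB.instance Definition _ := [SubChoice_isSubLmodule of csub_sort by <:].

Definition csub_norm (x : csub_sort) : R := `|csub_val x|.

Lemma csub_normD x y : csub_norm (x + y) <= csub_norm x + csub_norm y.
Proof. exact: ler_normD. Qed.

Lemma csub_normZ (a : R) x : csub_norm (a *: x) = `|a| * csub_norm x.
Proof. exact: normrZ. Qed.

Lemma csub_norm0_eq0 x : csub_norm x = 0 -> x = 0.
Proof. by move=> /normr0_eq0 x0; apply: val_inj. Qed.

HB.instance Definition _ := Lmodule_isNormed.Build R csub_sort
  csub_normD csub_normZ csub_norm0_eq0.

Lemma csub_mem v : csub_set S v -> exists x : csub_sort, csub_val x = v.
Proof. by move=> Sv; exists (CSub (asboolT Sv)). Qed.

Lemma csub_valS (x : csub_sort) : csub_set S (csub_val x).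
Proof. by case: x => v /= /asboolP. Qed.

Lemma csub_complete (F : set_system csub_sort) : ProperFilter F -> cauchy F -> cvg F.
Proof.
move=> FF /cauchyP Fc.
have /cvg_ex[/= l Fl] : cvg (csub_val @ F).
  apply/cauchy_cvgP/cauchy_exP => e e0; have [x Fx] := Fc e e0.
  exists (csub_val x); rewrite -ball_normE.
  suff : F [set y | `|csub_val x - csub_val y| < e] by [].
  by move: Fx; rewrite -ball_normE.
have Sl : csub_set S l.
  suff : closure (csub_set S) l by exact: csub_closed.
  move=> B Bl; have /filter_ex[x Bx] : F (csub_val @^-1` B) := Fl _ Bl.
  by exists (csub_val x); split => //; exact: csub_valS.
have [x xl] := csub_mem Sl; apply/cvg_ex; exists x.
apply/cvgrPdist_lt => e e0; move: Fl => /cvgrPdist_lt/(_ e e0).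
by rewrite -xl; apply: filterS.
Qed.

HB.instance Definition _ := Uniform_isComplete.Build csub_sort csub_complete.

Lemma csub_val_map : exists J : {linear csub_sort -> V}, forall v, J v = csub_val v.
Proof. exact: linear_mk. Qed.

Lemma csub_separable : separable V -> separable csub_sort.
Proof.
move=> /separable_enum[D DP].
have /choice[f fP] (nk : nat * nat) : exists x : csub_sort,
    forall y : csub_sort, `|csub_val y - D nk.1| < pow2 nk.2 -> `|csub_val x - D nk.1| < pow2 nk.2.
  have [[y yD]|none] := pselect (exists y : csub_sort, `|csub_val y - D nk.1| < pow2 nk.2).
    by exists y.
  by exists 0 => y yD; case: none; exists y.
exists (range f).
  by apply: sub_countable (card_image_le _ _) _; exact: countableP.
move=> O [x Ox] Oo.
have /nbhs_ballP[e /= e0 eO] := open_nbhs_nbhs (conj Oo Ox).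
have [k kP] := pow2_small (divr_gt0 e0 (ltr0n R 2)).
have [n nP] := DP (csub_val x) _ (pow2_gt0 k).
exists (f (n, k)); split; last by exists (n, k).
apply: eO; rewrite -ball_normE /=.
change (`|csub_val x - csub_val (f (n, k))| < e).
rewrite (le_lt_trans (ler_distD (D n) _ _))// [`|D n - _|]distrC.
by have := fP (n, k) x nP; have := kP k (leqnn _) => /=; lra.
Qed.

End closed_subspace_complete.

Section closed_span.
Context {R : realType} {V : normedModType R} (z : nat -> V).

Definition closed_span : set V := closure (range (fun nc => lc nc.1 nc.2 z)).

Lemma closed_spanP v : closed_span v <->
  forall e : R, 0 < e -> exists n c, `|v - lc n c z| < e.
Proof.
split=> [vz e e0|vz B /nbhs_ballP[e /= e0 eB]].
  have [_ [[[n c] _ <-]]] := vz _ (nbhsx_ballx v e e0).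
  by rewrite -ball_normE; exists n, c.
have [n [c vnc]] := vz e e0; exists (lc n c z); split; first by exists (n, c).
by apply: eB; rewrite -ball_normE.
Qed.

Lemma closed_span_submod : submod_closed [pred v | `[< closed_span v >]].
Proof.
split=> [|a v w].
  apply/asboolP/closed_spanP => e e0; exists 0%N, (fun=> 0).
  by rewrite /lc big_ord0 subrr normr0.
move=> /asboolP/closed_spanP vz /asboolP/closed_spanP wz.
apply/asboolP/closed_spanP => e e0.
have a1 : 0 < `|a| + 1 by rewrite ltr_wpDl.
have e20 : 0 < e / 2 by rewrite divr_gt0.
have [n [c vc]] := vz _ (divr_gt0 e20 a1).
have [n' [c' wc']] := wz _ e20.
exists (maxn n n'), (fun i => a * (if (i < n)%N then c i else 0) +
  (if (i < n')%N then c' i else 0)).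
rewrite lc_linear -!lc_widen ?leq_maxl ?leq_maxr//.
rewrite opprD addrACA -scalerBr (le_lt_trans (ler_normD _ _))// (splitr e).
rewrite normrZ ler_ltD//.
rewrite (@le_trans _ _ ((`|a| + 1) * (e / 2 / (`|a| + 1))))//.
  by apply: ler_pM => //; [rewrite lerDl | exact: ltW].
by rewrite mulrC divfK// gt_eqF.
Qed.

Definition closed_span_subspace : closed_subspace V :=
  ClosedSubspace closed_span_submod (@closed_closure _ _).

End closed_span.

Section limit_space.
Context {R : realType} (X : completeNormedModType R).
Hypothesis cptX : forall n, compact [set: orbit_quotient (Iso_action X n)].
Variable z : nat -> X.
Hypothesis z_guarded : forall n (e : R), 0 < e -> exists n' m d,
  [/\ (n <= n')%N, (n' <= m)%N, 0 < d & guarded n' m e d z].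
Hypothesis z_copies : forall n m a b p (g : nat -> X) (h : R), (n <= m)%N ->
  (m <= p)%N -> guarded n m (pow2 b) (pow2 a) z -> sim m (pow2 a) g z -> 0 < h ->
  exists2 q, sim p h (fun i => z (q + i)%N) g &
    forall i, (i < n)%N -> `|z (q + i)%N - z i| < pow2 b.

Let Z : completeNormedModType R := csub_sort (closed_span_subspace z).

Lemma limit_basis : exists zz : nat -> Z, forall i, csub_val (zz i) = z i.
Proof.
suff /choice[zz zzP] i : exists w : Z, csub_val w = z i by exists zz.
apply: csub_mem; apply/closed_spanP => e e0.
by exists i.+1, (fun j => (i == j)%:R); rewrite lc1// subrr normr0.
Qed.

Lemma sim_csub_val n (x : nat -> Z) : sim n 0 (@csub_val _ _ _ \o x) x.
Proof.
have [J JE] := csub_val_map (closed_span_subspace z).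
apply: (sim_eql (x := J \o x)) => [i _|]; first by rewrite /= JE.
by apply: sim_iso => v; rewrite JE.
Qed.

Lemma limit_copy p (g : nat -> X) (h : R) : 0 < h -> exists g' : nat -> Z, sim p h g' g.
Proof.
move=> h0; have [zz zzE] := limit_basis.
have [n [m [d [_ nm d0 gz]]]] := z_guarded 0 (pow2_gt0 0).
have [a aP] := pow2_small d0.
have gza : guarded n m (pow2 0) (pow2 a) z by apply: guarded_le gz => //; exact/ltW/aP.
have gz1 : sim m (pow2 a) (cat_seq m z g) z.
  apply: (sim_le (ltW (pow2_gt0 a))); apply: sim_eq => i im.
  by rewrite cat_seql.
have [q qg _] := z_copies nm (leq_addr p m) gza gz1 h0.
exists (fun i => zz (q + (m + i))%N).
apply: sim_trans0l (sim_sym (sim_csub_val _ _)) _.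
apply: (sim_eql (x := fun i => z (q + (m + i))%N)) => [i _|]; first by rewrite /= zzE.
apply: sim_trans0r (sim_shift (ltW h0) (leqnn (m + p)) qg) _.
by apply: sim_eq => i _; rewrite cat_seqr.
Qed.

(** A tuple of the limit space is approximated by combinations of the first
    entries of the generic sequence. A guard of those entries, fine enough for
    the coefficients of the combinations, serves as a guard of the tuple. *)
Lemma limit_extension : extension_property Z.
Proof.
move=> s x e e0; have [zz zzE] := limit_basis.
have e80 : 0 < e / 8 by rewrite divr_gt0.
have [N [a aP]] : exists N (a : nat -> nat -> R), forall i, (i < s)%N ->
    `|csub_val (x i) - lc N (a i) z| < e / 8.
  have /choice[nc ncP] i : exists nc : nat * (nat -> R),
      `|csub_val (x i) - lc nc.1 nc.2 z| < e / 8.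
    have /closed_spanP/(_ _ e80)[n [c xnc]] := csub_valS (x i).
    by exists (n, c).
  exists (\max_(i < s) (nc i).1).
  exists (fun i j => if (j < (nc i).1)%N then (nc i).2 j else 0) => i si.
  by rewrite -lc_widen ?ncP// (leq_bigmax (Ordinal si)).
pose A := 1 + \sum_(i < s) l1norm N (a i).
have A1 : 1 <= A by rewrite lerDl sumr_ge0// => i _; exact: l1norm_ge0.
have A0 : 0 < A := lt_le_trans ltr01 A1.
have aA i : (i < s)%N -> 1 + l1norm N (a i) <= A.
  move=> si; rewrite /A (bigD1 (Ordinal si))//= lerD2l lerDl sumr_ge0// => j _.
  exact: l1norm_ge0.
have eA0 : 0 < e / 8 / A by rewrite divr_gt0.
have [b bP] := pow2_small eA0.
have [n0 [m0 [d [Nn nm d0 gz]]]] := z_guarded N (pow2_gt0 b).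
have [k kP] := pow2_small d0.
have gzk : guarded n0 m0 (pow2 b) (pow2 k) z.
  by apply: guarded_le gz => //; exact/ltW/kP.
pose d1 := Num.min (pow2 k) (e / 8 / A).
have d10 : 0 < d1 by rewrite lt_min pow2_gt0.
pose x' := cat_seq s x zz.
exists (s + m0)%N, x', d1; split => // [|i si|p g h mp gx' h0]; first exact: leq_addr.
  by rewrite /x' cat_seql.
pose gX := (@csub_val _ _ _ \o g) : nat -> X.
have gXx' : sim (s + m0) d1 gX x' := sim_trans0l (sim_csub_val _ g) gx'.
pose g2 := cat_seq m0 (fun j => gX (s + j)%N) gX.
have g2z : sim m0 (pow2 k) g2 z.
  apply: (sim_eql (x := fun j => gX (s + j)%N)) => [i im|].
    by rewrite /g2 cat_seql.
  apply: (sim_le (d := d1)); first by rewrite ge_min lexx.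
  apply: sim_trans0r (sim_shift (ltW d10) (leqnn (s + m0)) gXx') _.
  apply: sim_sym; apply: sim_eql (sim_csub_val m0 _) => i _.
  by rewrite /= /x' cat_seqr zzE.
pose h1 := Num.min h (e / 8 / A).
have h10 : 0 < h1 by rewrite lt_min h0.
have [q qg qz] := z_copies nm (leq_addr p m0) gzk g2z h10.
exists (fun i => zz (q + (m0 + i))%N) => [|i si].
  apply: sim_trans0l (sim_sym (sim_csub_val _ _)) _.
  apply: (sim_eql (x := fun i => z (q + (m0 + i))%N)) => [i _|]; first by rewrite /= zzE.
  apply: (sim_le (d := h1)); first by rewrite ge_min lexx.
  apply: sim_trans0r (sim_shift (ltW h10) (leqnn (m0 + p)) qg) _.
  apply: (sim_eql (x := gX)) (sim_csub_val _ g) => i _.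
  by rewrite /g2 cat_seqr.
rewrite {1}/x' cat_seql//; change (`|csub_val (zz (q + (m0 + i))%N) - csub_val (x i)| < e); rewrite zzE.
have aE : (1 + l1norm N (a i)) * (e / 8 / A) <= e / 8.
  by rewrite mulrA ler_pdivrMr// mulrC (ler_wpM2l (ltW e80))// aA.
have a0 := l1norm_ge0 N (a i).
have jm0 j : (j < N)%N -> (j < m0)%N.
  by move=> jN; exact: leq_trans jN (leq_trans Nn nm).
have t1 : `|z (q + (m0 + i))%N - lc N (a i) (fun j => z (q + j)%N)| <=
    `|g2 (m0 + i)%N - lc N (a i) g2| + e / 8.
  have ip : (m0 + i < m0 + p)%N.
    by rewrite ltn_add2l (leq_trans si)// (leq_trans _ mp)// leq_addr.
  have jp j : (j < N)%N -> (id j < m0 + p)%N.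
    by move=> /jm0 jm; exact: leq_trans jm (leq_addr _ _).
  apply: le_trans (sim_relation (a i) (ltW h10) ip jp qg) _.
  rewrite lerD2l (le_trans _ aE)// mulrC ler_wpM2l ?addr_ge0//.
  by rewrite ge_min lexx orbT.
have t2 : `|g2 (m0 + i)%N - lc N (a i) g2| <= e / 8 + e / 8.
  rewrite /g2 cat_seqr (@eq_lc _ _ _ _ _ (gX \o addn s)) => [|j jN]; last first.
    by rewrite cat_seql//; exact: jm0.
  have im : (i < s + m0)%N by exact: leq_trans si (leq_addr _ _).
  have jm j : (j < N)%N -> (s + j < s + m0)%N by rewrite ltn_add2l; exact: jm0.
  apply: le_trans (sim_relation (a i) (ltW d10) im jm gXx') _.
  apply: lerD; last first.
    rewrite (le_trans _ aE)// mulrC ler_wpM2l ?addr_ge0//.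
    by rewrite ge_min lexx orbT.
  rewrite /x' cat_seql// (@eq_lc _ _ _ _ _ zz) => [|j _]; last by rewrite /= cat_seqr.
  have [J JE] := csub_val_map (closed_span_subspace z).
  change (`|csub_val (x i - lc N (a i) zz)| <= e / 8).
  rewrite -JE linearB -lc_map (@eq_lc _ _ _ _ _ z) => [|j _]; last by rewrite /= JE zzE.
  by rewrite JE ltW// aP.
have t3 : `|lc N (a i) (fun j => z (q + j)%N) - lc N (a i) z| <= e / 8.
  apply: le_trans (dist_lc_le (d := e / 8 / A) _ _) _ => [j jN|].
    apply: ltW; apply: lt_trans (qz j _) _; first exact: leq_trans jN Nn.
    exact: bP.
  by rewrite (le_trans _ aE)// mulrC (ler_wpM2r (ltW eA0))// lerDr.
have := aP i si; rewrite distrC => t4.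
have := ler_distD (lc N (a i) (fun j => z (q + j)%N)) (z (q + (m0 + i))%N) (csub_val (x i)).
have := ler_distD (lc N (a i) z) (lc N (a i) (fun j => z (q + j)%N)) (csub_val (x i)).
lra.
Qed.

Lemma limit_Age_cl : Age_cl Z = Age_cl X.
Proof.
have [J JE] := csub_val_map (closed_span_subspace z).
apply/seteqP; split=> E /Age_cl_Emb Eemb; apply/Age_cl_Emb => d d0.
  by have [i iP] := Eemb d d0; exists (J \o i) => v; rewrite /= JE; exact: iP.
have /AgeP[j j1] : Age X E by exact: Age_of_Emb.
have [h h0 hP] := Emb_of_sim E d0.
have [g gj] := limit_copy (fddim E) (j \o @std_basis R E) h0.
have [T TE] := tuple_linear E g.
exists T; apply: hP TE _.
exact: sim_trans0r gj (sim_iso _ _ j1).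
Qed.

End limit_space.

Lemma Flim_exists (R : realType) (X : completeNormedModType R) : separable X ->
  (forall n, compact [set: orbit_quotient (Iso_action X n)]) ->
  exists Z : completeNormedModType R, is_Flim X Z.
Proof.
move=> sepX cptX; have [D DP] := separable_enum sepX.
have [z [z_guarded z_copies]] := generic_sequence cptX DP.
exists (csub_sort (closed_span_subspace z)); split; last exact: limit_Age_cl.
apply: extension_guarded_Fraisse; first exact: csub_separable.
exact: limit_extension.
Qed.

(** * Limits of omega-categorical spaces *)

Section compact_quotient.
Context {R : realType} (Z : completeNormedModType R).

Lemma ultra_cover T (F : set_system T) N (B : nat -> set T) : UltraFilter F ->
  (forall x, exists2 j, (j < N)%N & B j x) -> exists j, F (B j).
Proof.
move=> FU cov; apply: contrapT => /forallNP none.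
have FC M : F [set x | forall j, (j < M)%N -> ~ B j x].
  elim: M => [|M IH]; first by apply: filterS filterT.
  have [/none//|FBC] := in_ultra_setVsetC (B M) FU.
  apply: filterS2 IH FBC => x xM xB j; rewrite ltnS leq_eqVlt => /orP[/eqP->//|].
  exact: xM.
have /filter_ex[x xN] := FC N.
by have [j jN Bj] := cov x; exact: xN jN Bj.
Qed.

Lemma ball_tuple_dist_lt n (x y : ball_tuple Z n) (e : R) : 0 < e ->
  (forall i, `|sval x i - sval y i| < e) -> mdist x y < e.
Proof. by move=> e0 xy; apply/bigmax_ltP; split. Qed.

(** A cover by finitely many small sets for each scale gives, along an
    ultrafilter, a Cauchy sequence of orbits; it lifts to a Cauchy sequence of
    tuples. *)
Lemma compact_of_orbit_net n :
  (forall e : R, 0 < e -> exists s, orbit_net n 1 e s (X := Z)) ->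
  compact [set: orbit_quotient (Iso_action Z n)].
Proof.
move=> net; rewrite compact_ultra => F FU _.
pose q := orbit_class (Iso_action Z n).
pose near_tuple (c : nat -> Z) (e : R) : set (orbit_quotient (Iso_action Z n)) :=
  [set A | exists2 y, A = q y & forall i, `|sval y i - c i| < e].
have near_dist c e A B : 0 < e -> near_tuple c e A -> near_tuple c e B ->
    orbit_dist A B < e + e.
  move=> e0 [y -> yc] [w -> wc]; apply: le_lt_trans (orbit_class_dist_le _ _ _) _.
  apply: ball_tuple_dist_lt => [|i]; first exact: addr_gt0.
  by rewrite (le_lt_trans (ler_distD (c i) _ _))// ltrD// distrC.
have /choice[C CP] k : exists c, F (near_tuple c (pow2 k)).
  have [s sP] := net _ (pow2_gt0 (R := R) k).
  have [|j jF] := @ultra_cover _ F (size s) (fun j => near_tuple (nth (fun=> 0) s j) (pow2 k)) FU.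
    move=> A; have [y ->] := orbit_class_surj A.
    pose y1 i := if insub i is Some i' then sval y i' else 0.
    have [i ni|j js [T TI Ty]] := sP y1.
      by rewrite /y1 insubT; exact: (proj2_sig y).
    exists j => //; have [g gT] := diagonal_act_ex n TI.
    exists (g y); first by rewrite /q orbit_class_act//; exists T.
    move=> i; rewrite gT (set_nth_default y1)//.
    by have := Ty i (ltn_ord i); rewrite /y1 valK.
  by exists (nth (fun=> 0) s j).
have /choice[A AP] k : exists A, near_tuple (C k) (pow2 k) A /\
    near_tuple (C k.+1) (pow2 k.+1) A.
  have /filter_ex[A [A1 A2]] : F (near_tuple (C k) (pow2 k) `&`
      near_tuple (C k.+1) (pow2 k.+1)) by exact: filterI.
  by exists A.
have Adist k : orbit_dist (A k) (A k.+1) < pow2 k.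
  rewrite (pow2S k); apply: near_dist (pow2_gt0 _) (AP k).2 (AP k.+1).1.
have [a0 a0E] := orbit_class_surj (A 0%N).
have [k a _ aA|a _ aP] := @chain_choice _ (fun k a => A k = q a)
    (fun k a b => mdist a b < pow2 k) 0 a0 a0E.
  have [b bE] := orbit_class_surj (A k.+1).
  have := Adist k; rewrite aA bE => /orbit_class_dist_lt[g gG ab].
  by exists (g b) => //=; rewrite /q orbit_class_act.
have aE k : A k = q (a k) by have [] := aP k (leq0n k).
have aS k : mdist (a k) (a k.+1) < pow2 k by have [] := aP k (leq0n k).
have /choice[l lP] i : exists l, forall k, `|l - sval (a k) i| <= pow2 k + pow2 k.
  have [k _|l lP] := @pow2_cauchy_cvg R Z (fun k => sval (a k) i) 0.
    rewrite distrC (le_trans _ (ltW (aS k)))//; exact: le_ball_tuple_dist.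
  by exists l => k; exact: lP.
have l1 i : `|l i| <= 1.
  apply/ler_addgt0Pl => e e0; have [N NP] := pow2_small (divr_gt0 e0 (ltr0n R 2)).
  rewrite -(subrK (sval (a N) i) (l i)) (le_trans (ler_normD _ _))// lerD//.
    by apply: le_trans (lP i N) _; have := NP N (leqnn _); lra.
  exact: (proj2_sig (a N)).
pose L : ball_tuple Z n := exist _ l l1.
exists (q L); split => // B /nbhs_ballP[e /= e0 eB].
have [N NP] := pow2_small (divr_gt0 e0 (ltr0n R 8)).
have {}NP := NP N (leqnn _); have pN := pow2_gt0 (R := R) N.
apply: filterS (CP N) => D DN; apply: eB; rewrite ballEmdist /=.
apply: le_lt_trans (metric_triangle _ (A N) _) _.
have LA : mdist (q L) (A N) < pow2 N *+ 4.
  rewrite aE; apply: le_lt_trans (orbit_class_dist_le _ _ _) _.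
  apply: ball_tuple_dist_lt => [|i]; first by rewrite mulrn_wgt0.
  by apply: le_lt_trans (lP i N) _; rewrite -mulr2n ltr_pMn2l.
have AD : mdist (A N) D < pow2 N + pow2 N by exact: near_dist (AP N).1 DN.
by lra.
Qed.

End compact_quotient.

Section limits_are_categorical.
Context {R : realType} (X Z : completeNormedModType R).
Hypothesis cptX : forall n, compact [set: orbit_quotient (Iso_action X n)].
Hypothesis ageZX : Age_cl Z = Age_cl X.

Lemma Emb_from_age (E : fdspace R) (j : {linear E -> X}) (d : R) : (forall v, `|j v| = `|v|) ->
  0 < d -> exists i : {linear E -> Z}, Emb d E Z i.
Proof.
move=> j1 d0; suff /Age_cl_Emb/(_ d d0) : Age_cl Z E by [].
by rewrite ageZX; apply: subset_closure; apply/AgeP; exists j.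
Qed.

Lemma limit_infinite_dimensional : infinite_dimensional X -> infinite_dimensional Z.
Proof.
move=> /infinite_dimensional_independent indX [n [v vZ]].
have [x xi] := indX n.+1.
have [L [J [J1 Jx _]]] := span_fdspace n.+1 x.
have [th thP] := Emb_from_age J1 ltr01.
have /choice[f fP] i : exists u, (i < n.+1)%N -> J u = x i.
  have [ni|_] := ltnP i n.+1; last by exists 0.
  by have [u uE] := Jx i ni; exists u.
suff : (n.+1 <= n)%N by rewrite ltnn.
pose w i := if insub i is Some i' then v i' else 0 : Z.
apply: (@independent_le R Z n.+1 n (th \o f) w) => [c|i _].
  rewrite lc_map => c0; apply: xi.
  have f0 : lc n.+1 c f = 0.
    have /andP[+ _] := thP (lc n.+1 c f).
    by rewrite c0 normr0 pmulr_rle0 ?expR_gt0// normr_le0 => /eqP.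
  by rewrite -(eq_lc c fP) (lc_map J n.+1 c f) f0 linear0.
have : [set: Z] ((th \o f) i) by [].
rewrite -vZ (_ : v = (fun i : 'I_n => w i)); last first.
  by apply/funext => k; rewrite /w valK.
by rewrite span_lc => -[c _ <-]; exists c.
Qed.

Hypothesis fraisseZ : guarded_Fraisse_space Z.

(** The guard of [x] in Z embeds isometrically into X, because the age of X is
    closed; [W] lists the copy of [x], then a basis of the copy of the guard. If a
    space containing the copy is sent almost isometrically into Z, then the guard
    has two almost isometric embeddings into Z, this one and the inclusion, and they
    are almost conjugate on [x]. *)
Lemma guard_transfer n (x : nat -> Z) (e : R) : 0 < e ->
  (forall i, (i < n)%N -> `|x i| <= 1) ->
  exists p (W : nat -> X) (d : R), [/\ (n <= p)%N, 0 < d, sim n 0 W x &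
    forall (L : fdspace R) (J : {linear L -> X}) (th : {linear L -> Z}),
      (forall v, `|J v| = `|v|) -> (forall i, (i < p)%N -> exists v, J v = W i) ->
      Emb d L Z th ->
      exists2 T, Iso Z T & forall i u, (i < n)%N -> J u = W i -> `|th u - T (x i)| < e].
Proof.
move=> e0 x1; have [_ fZ] := fraisseZ.
have finE : exists m (v : 'I_m -> Z), range (fun c => lc n c x) = Defs.span v.
  by exists n, (fun i : 'I_n => x i); rewrite span_lc.
pose E := FdSubspace finE.
have [d [F [EF [d0 dP]]]] := fZ E e e0.
have [B [T0 [T01 T0s]]] := fdsub_fdspace F.
have [S SP] : exists S : {linear F -> B}, forall v, T0 (S v) = v.
  apply: (linear_factor (A := idfun)) => // v.
  by have [u _ uv] : range T0 v by [rewrite T0s]; exists u.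
have [JF JFE] := fdsub_val_map F.
have /AgeP[j j1] : Age X B.
  rewrite -Age_clE// -ageZX; apply: subset_closure; apply/AgeP.
  by exists (JF \o T0) => v; rewrite /= JFE -T01.
have /choice[f fP] i : exists v : E, (i < n)%N -> fdsub_val v = x i.
  have [ni|_] := ltnP i n; last by exists 0.
  have [|v vE] := @fdsub_mem R Z E (x i); last by exists v.
  by exists (fun k => (i == k)%:R) => //; exact: lc1.
pose jF : {linear F -> X} := j \o S.
have jF1 v : `|jF v| = `|v| by rewrite /= j1 -T01 SP.
pose y i := jF (fdsub_incl EF (f i)).
exists (n + fddim B)%N, (cat_seq n y (j \o @std_basis R B)), d; split => //.
- exact: leq_addr.
- apply: (sim_eql (x := jF \o (fun i => fdsub_incl EF (f i)))) => [i ni|].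
    by rewrite cat_seql.
  apply: sim_trans0l (sim_iso _ _ jF1) _; apply: sim_sym.
  apply: (sim_eql (x := JF \o (fun i => fdsub_incl EF (f i)))) => [i ni|].
    by rewrite /= JFE /= fP.
  by apply: sim_iso => v; rewrite JFE.
move=> L J th J1 JW thd.
have [psi psiE] : exists psi : {linear F -> L}, forall v, J (psi v) = jF v.
  apply: linear_factor => // v; rewrite /= linear_coord.
  rewrite -(@eq_lc R _ _ _ (fun i => cat_seq n y (j \o @std_basis R B) (n + i)%N)).
    by apply: range_lc => i iB; apply: JW; rewrite ltn_add2l.
  by move=> i iB; rewrite cat_seqr.
have psi1 v : `|psi v| = `|v| by rewrite -J1 psiE jF1.
have [||T TI Te] := dP JF (th \o psi).
- by apply: (Emb_of_isometry (ltW d0)) => v; rewrite JFE.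
- by move=> v; rewrite -psi1; exact: thd.
exists T => // i u ni uW.
have -> : u = psi (fdsub_incl EF (f i)).
  apply/eqP; rewrite -subr_eq0 -normr_eq0 -J1 linearB uW psiE cat_seql//.
  by rewrite subrr normr0.
rewrite -(fP i ni); apply: le_lt_trans Te.
have -> : fdsub_val (f i) = JF (fdsub_incl EF (f i)) by rewrite JFE.
apply: ub_le_sup; last by exists (f i) => //=; rewrite -[`|f i|]/(`|fdsub_val (f i)|) fP// x1.
exists (expR d + 1) => _ [v /= v1 <-].
have inclN : `|fdsub_incl EF v| <= 1 by [].
rewrite (le_trans (ler_normB _ _))// lerD//.
  have /andP[_ /le_trans] := thd (psi (fdsub_incl EF v)); apply.
  by rewrite psi1 ler_piMr ?expR_ge0.
by rewrite TI.1 JFE.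
Qed.

(** Two tuples of Z whose copies in X lie, up to isometries of X, close to the same
    point of a net of X are close to each other up to isometries of Z: the copies of
    their guards can be put into one finite-dimensional subspace of X, which almost
    embeds back into Z. *)
Lemma limit_orbit_net n (e : R) : 0 < e -> exists s, orbit_net n 1 e s (X := Z).
Proof.
move=> e0; have e40 : 0 < e / 4 by rewrite divr_gt0.
have e80 : 0 < e / 8 by rewrite divr_gt0.
have [s sP] := orbit_net_exists cptX n 1 e80.
pose inball (x : nat -> Z) := forall i, (i < n)%N -> `|x i| <= 1.
pose P (x : nat -> Z) (w : nat * (nat -> X) * R) := [/\ (n <= w.1.1)%N, 0 < w.2,
  sim n 0 w.1.2 x & forall (L : fdspace R) (J : {linear L -> X}) (th : {linear L -> Z}),
      (forall v, `|J v| = `|v|) -> (forall i, (i < w.1.1)%N -> exists v, J v = w.1.2 i) ->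
      Emb w.2 L Z th ->
      exists2 T, Iso Z T & forall i u, (i < n)%N -> J u = w.1.2 i -> `|th u - T (x i)| < e / 4].
have /choice[w wP] x : exists w, inball x -> P x w.
  have [x1|nx] := pselect (inball x); last by exists (0%N, fun=> 0, 0).
  by have [p [W [d Wd]]] := guard_transfer e40 x1; exists (p, W, d).
pose hits j x := exists2 T, Iso X T &
  forall i, (i < n)%N -> `|T ((w x).1.2 i) - nth (fun=> 0) s j i| < e / 8.
have /choice[rep repP] j : exists x, forall y, inball y -> hits j y -> inball x /\ hits j x.
  have [[y [y1 yj]]|none] := pselect (exists y, inball y /\ hits j y).
    by exists y.
  by exists (fun=> 0) => y y1 yj; case: none; exists y.
exists (mkseq rep (size s)) => y y1.
have [yp yd yW yT] := wP y y1.
have [i ni|j js [T TI Ty]] := sP (w y).1.2.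
  have := sim0P yW (fun k => (i == k)%:R); rewrite !lc1// => ->.
  exact: y1.
have yj : hits j y.
  by exists T => // i ni; rewrite (set_nth_default (w y).1.2)//; exact: Ty.
exists j; first by rewrite size_mkseq.
rewrite nth_mkseq//.
have [x1 [S SI Sx]] := repP j y y1 yj; set x := rep j in x1 Sx *.
have [xp xd xW xT] := wP x x1.
have [S' [SI' SS' S'S]] := Iso_inv SI.
have [T' [TI' TT' T'T]] := Iso_inv TI.
pose Wy := (S' \o T) \o (w y).1.2.
have near i : (i < n)%N -> `|Wy i - (w x).1.2 i| < e / 8 + e / 8.
  move=> ni; rewrite /Wy /= -SI.1 linearB S'S.
  rewrite (le_lt_trans (ler_distD (nth (fun=> 0) s j i) _ _))//.
  rewrite ltrD//; last by rewrite distrC Sx.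
  by rewrite (set_nth_default (w y).1.2)//; exact: Ty.
have [L [J [J1 Jsp _]]] := span_fdspace ((w y).1.1 + (w x).1.1)
  (cat_seq (w y).1.1 Wy (w x).1.2).
have JWy i : (i < (w y).1.1)%N -> exists v, J v = Wy i.
  by move=> iy; have [|v vE] := Jsp i; [exact: ltn_addr|exists v; rewrite vE cat_seql].
have JWx i : (i < (w x).1.1)%N -> exists v, J v = (w x).1.2 i.
  move=> ix; have [|v vE] := Jsp ((w y).1.1 + i)%N; first by rewrite ltn_add2l.
  by exists v; rewrite vE cat_seqr.
(* [expR d <= 2] keeps the image in Z of a vector of norm [e / 4] below [e / 2] *)
pose d := Num.min (ln 2) (Num.min (w x).2 (w y).2) : R.
have d0 : 0 < d by rewrite !lt_min xd yd ln_gt0// ltr1n.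
have [th thd] := Emb_from_age J1 d0.
have Emb_le d' : d <= d' -> Emb d' L Z th.
  move=> dd v; have /andP[h1 h2] := thd v; apply/andP; split.
    by apply: le_trans h1; rewrite ler_wpM2r// ler_expR lerN2.
  by apply: le_trans h2 _; rewrite ler_wpM2r// ler_expR.
have [|A AI Ax] := xT L J th J1 JWx.
  by apply: Emb_le; rewrite /d !ge_min lexx !orbT.
have [|||B BI By] := yT L (T' \o S \o J) th.
- by move=> v; rewrite /= TI'.1 SI.1.
- move=> i iy; have [v vE] := JWy i iy; exists v.
  by rewrite /= vE /Wy /= S'S TT'.
- by apply: Emb_le; rewrite /d !ge_min lexx !orbT.
have [A' [AI' AA' A'A]] := Iso_inv AI.
exists (A' \o B); first exact: Iso_comp.
move=> i ni; rewrite /= -AI.1 linearB A'A.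
have [v vE] := JWy i (leq_trans ni yp); have [u uE] := JWx i (leq_trans ni xp).
have h1 := Ax i u ni uE.
have h2 : `|th v - B (y i)| < e / 4.
  by apply: By => //; rewrite /= vE /Wy /= S'S TT'.
have h3 : `|th v - th u| < e / 2.
  have dln2 : d <= ln 2 by rewrite /d ge_min lexx.
  rewrite -linearB; have /andP[_ /le_lt_trans] := Emb_le _ dln2 (v - u); apply.
  rewrite lnK ?posrE// -J1 linearB vE uE.
  by have := near i ni; lra.
have t1 := ler_distD (th v) (B (y i)) (A (x i)).
have t2 := ler_distD (th u) (th v) (A (x i)).
by rewrite [`|B (y i) - th v|]distrC in t1; lra.
Qed.

Lemma limit_omega_categorical : infinite_dimensional X -> omega_categorical Z.
Proof.
move=> infX; split; first exact: limit_infinite_dimensional.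
  by have [] := fraisseZ.
by move=> n; apply: compact_of_orbit_net => e; exact: limit_orbit_net.
Qed.

End limits_are_categorical.

Theorem theorem9p4 (R : realType) (X : completeNormedModType R)
    (sepX : separable X) (catX : omega_categorical X) :
  guarded_Fraisse_class (Age X) /\
  (exists Z : completeNormedModType R, is_Flim X Z) /\
  (forall Z : completeNormedModType R, is_Flim X Z -> omega_categorical Z).
Proof.
have [infX _ cptX] := catX.
split; first exact: Age_guarded_Fraisse.
split; first exact: Flim_exists.
by move=> Z [fraisseZ ageZ]; apply: (limit_omega_categorical cptX ageZ).
Qed.
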